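(* For every $a>0$, the functions $$z\mapsto C_{a,1}^1(z),\qquad z\mapsto zC_{a,1}^1(z),\qquad z\mapsto C_{a,1}^2(z)$$ are bounded on $(0,\infty)$. Consequently, $$c_a:=\sup_{z>0}C_{a,1}^1(z),\qquad d_a:=\sup_{z>0}zC_{a,1}^1(z),\qquad e_a:=\sup_{z>0}C_{a,1}^2(z)$$ are finite. Moreover, as $a\to\infty$, $$\sqrt a\,c_a\to\sqrt{\frac2\pi},\qquad \frac{d_a}{\sqrt a}\to\sqrt{\frac2\pi},\qquad \sqrt a\,e_a\to\sqrt{\frac\pi8}.$$
   Context: For $a>0$ let $p_{a,1}(x)=\frac1{\Gamma(a)}x^{a-1}e^{-x}$, $x>0$, be the density of the Gamma distribution with shape $a$ and scale $1$. For $x,y>0$ put $P_{a,1}(x)=\int_0^xp_{a,1}(u)\,du$, $\overline P_{a,1}(x)=\int_x^\infty p_{a,1}(u)\,du$, $\underline{\mathrm P}^1_{a,1}(x)=\int_0^xP_{a,1}(u)\,du$, $\overline{\mathrm P}^1_{a,1}(x)=\int_x^\infty\overline P_{a,1}(u)\,du$, $\underline M_{a,1}(y)=\frac{P_{a,1}(y)}{y\,p_{a,1}(y)}$, $\overline M_{a,1}(y)=\frac{\overline P_{a,1}(y)}{y\,p_{a,1}(y)}$ (smooth on $(0,\infty)$). For $z>0$ set $$C_{a,1}^1(z)=-\overline M_{a,1}'(z)\underline{\mathrm P}^1_{a,1}(z)+\underline M_{a,1}'(z)\overline{\mathrm P}^1_{a,1}(z),$$ $$C_{a,1}^2(z)=\overline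 M_{a,1}''(z)\int_0^z\underline{\mathrm P}^1_{a,1}(x)\,dx+\underline M_{a,1}''(z)\int_z^\infty\overline{\mathrm P}^1_{a,1}(x)\,dx.$$ *)

(* Defs.v *)
From HB Require Import structures.
From mathcomp Require Import all_boot all_order all_algebra.
From mathcomp Require Import all_classical all_reals all_analysis.

Set Implicit Arguments.
Unset Strict Implicit.
Unset Printing Implicit Defensive.

Import Order.TTheory GRing.Theory Num.Theory.
Import numFieldNormedType.Exports.

Local Open Scope classical_set_scope.
Local Open Scope ring_scope.

(* Everything below is only meaningful for a > 0 and for arguments in
   ]0, +oo[; the values taken elsewhere are irrelevant, since only integrals
   over subsets of ]0, +oo[ and derivatives at points of this open set are
   used. *)
Section GammaDistribution.
Context {R : realType}.
Notation mu := (@lebesgue_measure R).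
Implicit Types a x y z : R.

Definition Gamma a : R :=
  \int[mu]_(t in `]0, +oo[) (t `^ (a - 1) * expR (- t)).

Definition gamma_density a x : R :=
  (Gamma a)^-1 * x `^ (a - 1) * expR (- x).

Definition gamma_cdf a x : R := \int[mu]_(u in `]0, x]) gamma_density a u.

Definition gamma_tail a x : R := \int[mu]_(u in `[x, +oo[) gamma_density a u.

Definition gamma_cdf1 a x : R := \int[mu]_(u in `]0, x]) gamma_cdf a u.

Definition gamma_tail1 a x : R := \int[mu]_(u in `[x, +oo[) gamma_tail a u.

Definition lower_M a y : R := gamma_cdf a y / (y * gamma_density a y).

Definition upper_M a y : R := gamma_tail a y / (y * gamma_density a y).

Definition C1 a z : R :=
  - (upper_M a)^`()%classic z * gamma_cdf1 a z +
  (lower_M a)^`()%classic z * gamma_tail1 a z.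

Definition C2 a z : R :=
  (upper_M a)^`(2)%classic z * (\int[mu]_(x in `]0, z]) gamma_cdf1 a x) +
  (lower_M a)^`(2)%classic z * (\int[mu]_(x in `[z, +oo[) gamma_tail1 a x).

(* The suprema are taken in the extended reals, so that their finiteness is a
   genuine assertion. *)
Definition c_sup a : \bar R := ereal_sup [set (C1 a z)%:E | z in `]0, +oo[].

Definition d_sup a : \bar R :=
  ereal_sup [set (z * C1 a z)%:E | z in `]0, +oo[].

Definition e_sup a : \bar R := ereal_sup [set (C2 a z)%:E | z in `]0, +oo[].

End GammaDistribution.

(* Main.v *)
Require Import Defs.
From HB Require Import structures.
From mathcomp Require Import all_boot all_order all_algebra.
From mathcomp Require Import all_classical all_reals all_analysis.
From mathcomp Require Import measurable_realfun ring lra.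

(** Write [p] for the density, [q z = z * p z], [s = z - a], [P] and [Q = 1 - P]
for the distribution function and the tail, and [P1], [Q1], [P2], [Q2] for their
iterated integrals. Since [q' = (a - z) p], all of these are explicit:
[P1 = s P + q], [Q1 = q - s Q], [2 P2 = (s^2 + a) P + (s - 1) q] and
[2 Q2 = (s^2 + a) Q - (s - 1) q]. Then the derivatives of the Mills ratios collapse
to [P1 / (z q)], [- Q1 / (z q)], [2 P2 / (z^2 q)], [2 Q2 / (z^2 q)], so that
[C1 = 2 P1 Q1 / (z q)] and [C2 = 4 P2 Q2 / (z^2 q)]. The Wronskian identities
[P Q1 + Q P1 = q] and [P1 Q2 + P2 Q1 = z q / 2] bound [C1] and [C2] by [2], because
[P1 <= z P] and [P2 <= z P1]; for [z C1] one uses [Q1 <= z q / (s^2 + a)], which is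
[Q2 >= 0] in disguise.

At the mode [z = a] one has [P1 = Q1 = q], and this point is asymptotically optimal.
Away from it, at distance at least [8/5 sqrt a], log-concavity of the iterated
integrals ([P1 p <= P^2], [P2 P <= P1^2] and so on) turns the Wronskian identities into
[C1 <= 2 / sqrt (s^2 + 4 z)] and [C2 <= 2 / sqrt ((s - 1)^2 + 8 z)], which is already
smaller than the claimed limit. Near the mode, put [z = a + t sqrt a]. The products are
differences of squares, [4 P1 Q1 = (P1 + Q1)^2 - s^2] and
[4 P2 Q2 = ((s^2 + a) / 2)^2 - (P2 - Q2)^2], where [P1 + Q1] and [P2 - Q2] are iterated
integrals of [P - 1/2]. The density is uniformly close to a multiple of
[exp (- t^2 / 2)], and replacing this exponential by Taylor polynomials reduces the
comparison with the value at [t = 0] to two polynomial inequalities in [t^2].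
The height of the density at the mode and [P a -> 1/2] follow from the same
comparison, the tail bounds [Q <= q / s], [P <= q / |s|] and the Gauss integral. *)

Set Implicit Arguments.
Unset Strict Implicit.
Unset Printing Implicit Defensive.

Import Order.TTheory GRing.Theory Num.Theory.
Import numFieldNormedType.Exports.

Local Open Scope classical_set_scope.
Local Open Scope ring_scope.

(** * Differential calculus on a half-line *)

Section Calculus.
Context {R : realType}.
Implicit Types (f g : R -> R) (t x y z l d e : R).

Lemma is_derive_D f g x d e : is_derive x 1 f d -> is_derive x 1 g e ->
  is_derive x 1 (fun t => f t + g t) (d + e).
Proof. by move=> df dg; exact: is_deriveD. Qed.

Lemma is_derive_N f x d : is_derive x 1 f d ->
  is_derive x 1 (fun t => - f t) (- d).
Proof. by move=> df; exact: is_deriveN. Qed.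

Lemma is_derive_M f g x d e : is_derive x 1 f d -> is_derive x 1 g e ->
  is_derive x 1 (fun t => f t * g t) (f x * e + g x * d).
Proof. by move=> df dg; exact: is_deriveM. Qed.

Lemma is_derive_X f n x d : is_derive x 1 f d ->
  is_derive x 1 (fun t => f t ^+ n) (n%:R * f x ^+ n.-1 * d).
Proof. by move=> df; have := is_deriveX n df; rewrite exprfctE. Qed.

Lemma is_derive_V f x d : f x != 0 -> is_derive x 1 f d ->
  is_derive x 1 (fun t => (f t)^-1) (- d / f x ^+ 2).
Proof.
move=> fx0 df; have := is_deriveV fx0 df.
by rewrite /GRing.scale/= mulNr mulrC -mulNr.
Qed.

Lemma is_derive_comp f g x d e : is_derive (g x) 1 f d -> is_derive x 1 g e ->
  is_derive x 1 (fun t => f (g t)) (e * d).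
Proof. by move=> df dg; rewrite mulrC; exact: (@is_derive1_comp _ f g). Qed.

Lemma is_derive_exp f x d : is_derive x 1 f d ->
  is_derive x 1 (fun t => expR (f t)) (d * expR (f x)).
Proof. by move=> df; apply: is_derive_comp. Qed.

Lemma is_derive_const (c x : R) : is_derive x 1 (fun=> c) 0.
Proof. exact: is_derive_cst. Qed.

Lemma is_derive_var x : is_derive x 1 (fun t : R => t) 1.
Proof. exact: is_derive_id. Qed.

Lemma is_derive1E f x d : is_derive x 1 f d -> f^`()%classic x = d.
Proof. by move=> [_ <-]; rewrite derive1E. Qed.

Lemma is_derive_cvg f x d : is_derive x 1 f d -> f t @[t --> x] --> f x.
Proof. by move=> [/derivable1_diffP/differentiable_continuous]. Qed.

Lemma is_derive_le f (f' : R -> R) x y : x <= y ->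
  (forall t, x <= t <= y -> is_derive t 1 f (f' t)) ->
  (forall t, x < t < y -> 0 <= f' t) -> f x <= f y.
Proof.
rewrite le_eqVlt => /predU1P[<-//|xy] df f'0.
have [t txy fE] : exists2 c, c \in `]x, y[%R & f y - f x = f' c * (y - x).
  apply: MVT => // [t|].
    by rewrite in_itv/= => /andP[/ltW xt /ltW ty]; apply: df; rewrite xt.
  apply: derivable_within_continuous => t; rewrite in_itv/= => /df[].
  by [].
rewrite -subr_ge0 fE mulr_ge0 ?subr_ge0 ?(ltW xy)//; apply: f'0.
by move: txy; rewrite in_itv.
Qed.

Lemma is_derive_lt f (f' : R -> R) x y : x < y ->
  (forall t, x <= t <= y -> is_derive t 1 f (f' t)) ->
  (forall t, x < t < y -> 0 < f' t) -> f x < f y.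
Proof.
move=> xy df f'0.
have [t txy fE] : exists2 c, c \in `]x, y[%R & f y - f x = f' c * (y - x).
  apply: MVT => // [t|].
    by rewrite in_itv/= => /andP[/ltW xt /ltW ty]; apply: df; rewrite xt.
  apply: derivable_within_continuous => t; rewrite in_itv/= => /df[].
  by [].
rewrite -subr_gt0 fE mulr_gt0 ?subr_gt0//; apply: f'0.
by move: txy; rewrite in_itv.
Qed.

(** Monotonicity gives [f t <= f z] for small [t], and the limit passes to the bound. Most sign
    statements below come from this lemma or its three variants: a difference is differentiated, and
    its limit at one end of the half-line is computed. *)
Lemma is_derive_ge_lim0 f (f' : R -> R) l z : 0 < z ->
  (forall t, 0 < t -> is_derive t 1 f (f' t)) ->
  (forall t, 0 < t -> 0 <= f' t) -> f t @[t --> (0 : R)^'+] --> l -> l <= f z.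
Proof.
move=> z0 df f'0 fl; apply: (cvgr_to_le fl).
near=> t; have t0 : 0 < t by near: t; exact: nbhs_right_gt.
have tz : t <= z by near: t; exact: nbhs_right_le.
apply: (is_derive_le tz (f' := f')) => u /andP[tu _].
  by apply: df; exact: lt_le_trans tu.
by apply: f'0; exact: lt_trans tu.
Unshelve. all: by end_near. Qed.

Lemma is_derive_gt_lim0 f (f' : R -> R) l z : 0 < z ->
  (forall t, 0 < t -> is_derive t 1 f (f' t)) ->
  (forall t, 0 < t -> 0 < f' t) -> f t @[t --> (0 : R)^'+] --> l -> l < f z.
Proof.
move=> z0 df f'0 fl; have z20 : 0 < z / 2 by rewrite divr_gt0.
apply: (@le_lt_trans _ _ (f (z / 2))).
  by apply: (is_derive_ge_lim0 z20 df) => // t t0; exact/ltW/f'0.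
apply: (@is_derive_lt _ f'); first lra.
  by move=> t /andP[zt _]; apply: df; lra.
by move=> t /andP[zt _]; apply: f'0; lra.
Qed.

Lemma is_derive_ge_limy f (f' : R -> R) l z : 0 < z ->
  (forall t, 0 < t -> is_derive t 1 f (f' t)) ->
  (forall t, 0 < t -> f' t <= 0) -> f t @[t --> +oo] --> l -> l <= f z.
Proof.
move=> z0 df f'0 fl; apply: (cvgr_to_le fl).
near=> t; have zt : z <= t by near: t; exact: nbhs_pinfty_ge (num_real z).
rewrite -lerN2; apply: (@is_derive_le (fun u => - f u) (fun u => - f' u)) => //.
  by move=> u /andP[zu _]; apply: is_derive_N; apply: df; lra.
by move=> u /andP[zu _]; rewrite oppr_ge0; apply: f'0; lra.
Unshelve. all: by end_near. Qed.

Lemma is_derive_gt_limy f (f' : R -> R) l z : 0 < z ->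
  (forall t, 0 < t -> is_derive t 1 f (f' t)) ->
  (forall t, 0 < t -> f' t < 0) -> f t @[t --> +oo] --> l -> l < f z.
Proof.
move=> z0 df f'0 fl; have z10 : 0 < z + 1 by lra.
apply: (@le_lt_trans _ _ (f (z + 1))).
  by apply: (is_derive_ge_limy z10 df) => // t t0; exact/ltW/f'0.
rewrite -ltrN2; apply: (@is_derive_lt (fun u => - f u) (fun u => - f' u)); first lra.
  by move=> t /andP[zt _]; apply: is_derive_N; apply: df; lra.
by move=> t /andP[zt _]; rewrite oppr_gt0; apply: f'0; lra.
Qed.

Lemma is_derive_congr f x d e : is_derive x 1 f d -> d = e -> is_derive x 1 f e.
Proof. by move=> df <-. Qed.

(** Integrates an inequality between derivatives from 0 to [x]; repeated use builds Taylor bounds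
    degree by degree. *)
Lemma le_of_is_derive_le f g (f' g' : R -> R) x : 0 <= x -> f 0 <= g 0 ->
  (forall t, 0 <= t <= x -> is_derive t 1 f (f' t)) ->
  (forall t, 0 <= t <= x -> is_derive t 1 g (g' t)) ->
  (forall t, 0 <= t <= x -> f' t <= g' t) -> f x <= g x.
Proof.
move=> x0 fg0 df dg fg; rewrite -subr_ge0.
apply: (@le_trans _ _ (g 0 - f 0)); first by rewrite subr_ge0.
apply: (@is_derive_le (fun t => g t - f t) (fun t => g' t - f' t)) => //.
  by move=> t tx; apply: is_derive_D; [exact: dg|exact/is_derive_N/df].
by move=> t /andP[t0 tx]; rewrite subr_ge0 fg// !ltW.
Qed.

Lemma cvgy0_le_inv f (M : R) :
  (forall t, 1 <= t -> `|f t| <= M / t) -> f t @[t --> +oo] --> (0 : R).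
Proof.
move=> fM; have M0 : 0 <= M.
  by have := fM 1 (lexx _); rewrite divr1; exact: le_trans.
apply/cvgrPdist_le => e e0; near=> t.
have t1 : 1 <= t by near: t; exact: nbhs_pinfty_ge (num_real _).
have t0 : 0 < t := lt_le_trans ltr01 t1.
have tM : M / e <= t by near: t; exact: nbhs_pinfty_ge (num_real _).
rewrite sub0r normrN (le_trans (fM _ t1))// ler_pdivrMr//.
by rewrite mulrC -ler_pdivrMr.
Unshelve. all: by end_near. Qed.

End Calculus.

(** Synthesizes a derivative by recursion on the body of the function, closing the leaves with
    derivative facts from the context. Inverses leave a nonvanishing side condition. *)
Ltac der := cbv beta; lazymatch goal with
  | |- is_derive _ _ (fun _ => ?c) _ => apply is_derive_const
  | |- is_derive _ _ (fun t => t) _ => apply is_derive_var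
  | |- is_derive _ _ (fun t => @?f t + @?g t) _ =>
      eapply (@is_derive_D _ f g); [der | der]
  | |- is_derive _ _ (fun t => - (@?f t)) _ => eapply (@is_derive_N _ f); der
  | |- is_derive _ _ (fun t => @?f t * @?g t) _ =>
      eapply (@is_derive_M _ f g); [der | der]
  | |- is_derive _ _ (fun t => @?f t ^+ ?n) _ =>
      eapply (@is_derive_X _ f n); der
  | |- is_derive _ _ (fun t => expR (@?f t)) _ =>
      eapply (@is_derive_exp _ f); der
  | |- is_derive _ _ (fun t => (@?f t)^-1) _ =>
      eapply (@is_derive_V _ f); [cbv beta | der]
  | _ => first
    [ match goal with H : is_derive _ _ ?f _ |- is_derive _ _ ?g _ =>
        constr_eq f g; exact H end
    | match goal with H : is_derive _ _ ?f _ |- is_derive _ _ (fun t => ?g t) _ =>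
        constr_eq f g; exact H end
    | eassumption
    | match goal with H : _ |- _ => eapply H end | idtac]
  end.

(** The derivative is found as an existential variable first and compared with the expected
    expression afterwards, usually by [ring] or [field]. *)
Ltac derive := eapply is_derive_congr; [der | cbv beta; rewrite /=].

(** * Integrals with a known primitive *)

Section Integrals.
Context {R : realType}.
Notation mu := (@lebesgue_measure R).
Implicit Types (f F : R -> R) (l t x z : R).

Lemma integral_itvcy_derive f F l z : 0 < z ->
  (forall t, 0 < t -> {for t, continuous f}) ->
  (forall t, 0 < t -> 0 <= f t) ->
  (forall t, 0 < t -> is_derive t 1 F (f t)) -> F t @[t --> +oo] --> l ->
  (\int[mu]_(t in `[z, +oo[) (f t)%:E = (l - F z)%:E)%E.
Proof.
move=> z0 fC f0 dF Fl.
have itv0 t : t \in `]z, +oo[%R -> 0 < t.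
  by rewrite in_itv/= andbT; exact: lt_trans.
rewrite EFinB; apply: ge0_continuous_FTC2y => //.
- by move=> t zt; apply: f0; exact: lt_le_trans zt.
- apply: continuous_in_subspaceT => t; rewrite inE/= in_itv/= andbT => zt.
  by apply: fC; exact: lt_le_trans zt.
- by move=> t zt; have [] := dF _ (lt_trans z0 zt).
- by apply: cvg_at_right_filter; exact: is_derive_cvg (dF _ z0).
- by move=> t /itv0 t0; exact: is_derive1E (dF _ t0).
Qed.

Lemma continuous_measurable_itv0y f :
  (forall t, 0 < t -> {for t, continuous f}) ->
  measurable_fun `](0 : R), +oo[ f.
Proof.
move=> fC; apply: open_continuous_measurable_fun => //.
by move=> t; rewrite inE/= in_itv/= andbT => /fC.
Qed.

(** The integrand may blow up at 0, as the density does for [a < 1]. The interval is therefore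
    exhausted by compact intervals [[u n, z]], and monotone convergence is applied. *)
Lemma integral_itv0c_derive f F l z : 0 < z ->
  (forall t, 0 < t -> {for t, continuous f}) ->
  (forall t, 0 < t -> 0 <= f t) ->
  (forall t, 0 < t -> is_derive t 1 F (f t)) ->
  F t @[t --> (0 : R)^'+] --> l ->
  (\int[mu]_(t in `]0%R, z]) (f t)%:E = (F z - l)%:E)%E.
Proof.
move=> z0 fC f0 dF Fl.
(* The shift by two keeps [u n < z] strict already for [n = 0]. *)
pose u (n : nat) : R := z / n.+2%:R.
have u0 n : 0 < u n by rewrite divr_gt0.
have uz n : u n < z by rewrite /u ltr_pdivrMr// ltr_pMr// ltr1n.
have ucvg : u n @[n --> \oo] --> (0 : R).
  rewrite -(mulr0 z); apply: cvgM; first exact: cvg_cst.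
  by have := @cvg_harmonic R; rewrite -(@cvg_shiftS R).
have int_u n : (\int[mu]_(t in `[u n, z]) (f t)%:E = (F z - F (u n))%:E)%E.
  rewrite EFinB; apply: continuous_FTC2 => //.
  - apply: continuous_in_subspaceT => t; rewrite inE/= in_itv/= => /andP[ut _].
    by apply: fC; exact: lt_le_trans ut.
  - split=> [t||].
    + by rewrite in_itv/= => /andP[ut _]; have [] := dF _ (lt_trans (u0 n) ut).
    + by apply: cvg_at_right_filter; exact: is_derive_cvg (dF _ (u0 n)).
    + by apply: cvg_at_left_filter; exact: is_derive_cvg (dF _ z0).
  - move=> t; rewrite in_itv/= => /andP[ut _].
    exact: is_derive1E (dF _ (lt_trans (u0 n) ut)).
have U : `]0, z]%classic = \bigcup_n `[u n, z]%classic.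
  apply/seteqP; split => t /=.
    rewrite in_itv/= => /andP[t0 tz].
    have [n _ unt] : \forall n \near \oo, u n < t.
      exact: cvgr_lt ucvg _ t0.
    by exists n => //=; rewrite in_itv/= tz andbT ltW//; exact: (unt n (leqnn n)).
  by move=> [n _ /=]; rewrite !in_itv/= => /andP[ut ->]; rewrite (lt_le_trans (u0 n)).
have mf n : measurable_fun `[u n, z]%classic f.
  apply: measurable_funS (continuous_measurable_itv0y fC) => //.
  move=> t /=; rewrite !in_itv/= andbT => /andP[ut _].
  exact: lt_le_trans (u0 n) ut.
rewrite U.
apply: (cvg_unique _ (ge0_nondecreasing_set_cvg_integral _ _ _ _)) => //=.
- move=> m n mn; rewrite subsetEset; apply: subset_itvr.
  rewrite bnd_simp /u ler_pM2l// lef_pV2 ?posrE ?ltr0n// ler_nat.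
  by rewrite !ltnS.
- by move=> n; apply/measurable_EFinP; exact: mf.
- move=> n t /=; rewrite in_itv/= => /andP[ut _].
  by rewrite lee_fin f0//; exact: lt_le_trans ut.
- under eq_fun do rewrite int_u.
  apply: cvg_EFin; first exact: nearW.
  apply: cvgB; first exact: cvg_cst.
  by move/cvg_at_rightP : Fl; apply.
Qed.

Lemma integrable_itv0y f (M1 M2 : R) :
  (forall t, 0 < t -> {for t, continuous f}) ->
  (forall t, 0 < t -> 0 <= f t) ->
  (\int[mu]_(t in `]0%R, 1%R]) (f t)%:E <= M1%:E)%E ->
  (\int[mu]_(t in `[1%R, +oo[) (f t)%:E <= M2%:E)%E ->
  mu.-integrable `]0, +oo[ (EFin \o f).
Proof.
move=> fC f0 fM1 fM2; have mf := continuous_measurable_itv0y fC.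
apply/integrableP; split; first exact/measurable_EFinP.
have -> : (\int[mu]_(t in `]0%R, +oo[) `|(EFin \o f) t| =
           \int[mu]_(t in `]0%R, +oo[) (f t)%:E)%E.
  apply: eq_integral => t; rewrite inE/= in_itv/= andbT => t0.
  by rewrite ger0_norm ?f0.
have U : `]0, +oo[%classic = `]0, 1] `|` `](1 : R), +oo[.
  by rewrite -itv_bndbnd_setU// bnd_simp.
rewrite U ge0_integral_setU//; last 3 first.
- by rewrite -U; exact/measurable_EFinP.
- by move=> t; rewrite -U/= in_itv/= andbT lee_fin => /f0.
- apply/disj_setPS => t [] /=; rewrite !in_itv/= andbT => /andP[_].
  by rewrite leNgt => /negP.
rewrite [X in (_ + X)%E]integral_itv_obnd_cbnd; last first.
  apply/measurable_EFinP; apply: measurable_funS mf => //.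
  by rewrite U; exact: subsetUr.
by rewrite (le_lt_trans (leeD fM1 fM2))// -EFinD ltry.
Qed.

Lemma Rintegral_itv0c_derive f F z : 0 < z ->
  (forall t, 0 < t -> {for t, continuous f}) ->
  (forall t, 0 < t -> 0 <= f t) ->
  (forall t, 0 < t -> is_derive t 1 F (f t)) ->
  F t @[t --> (0 : R)^'+] --> (0 : R) ->
  \int[mu]_(t in `]0, z]) f t = F z.
Proof.
move=> z0 fC f0 dF F0.
by rewrite /Rintegral (integral_itv0c_derive z0 fC f0 dF F0) subr0.
Qed.

Lemma Rintegral_itvcy_derive f F z : 0 < z ->
  (forall t, 0 < t -> {for t, continuous f}) ->
  (forall t, 0 < t -> 0 <= f t) ->
  (forall t, 0 < t -> is_derive t 1 F (- f t)) ->
  F t @[t --> +oo] --> (0 : R) ->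
  \int[mu]_(t in `[z, +oo[) f t = F z.
Proof.
move=> z0 fC f0 dF F0.
have dNF t : 0 < t -> is_derive t 1 (fun t => - F t) (f t).
  by move=> t0; rewrite -[f t]opprK; apply: is_derive_N; exact: dF.
have NF0 : - F t @[t --> +oo] --> (0 : R) by rewrite -oppr0; exact: cvgN.
by rewrite /Rintegral (integral_itvcy_derive z0 fC f0 dNF NF0)/= sub0r opprK.
Qed.

End Integrals.

(** * The Gamma density *)

Section GammaKernel.
Context {R : realType}.
Notation mu := (@lebesgue_measure R).
Implicit Types (a b t x z : R).

(** The function [t ^ b exp (- t)] is largest at [t = b]: after taking logarithms this is
    [ln (1 + x) <= x] at [x = t / b - 1]. *)
Lemma powR_expR_le b t : 0 < b -> 0 < t ->
  t `^ b * expR (- t) <= b `^ b * expR (- b).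
Proof.
move=> b0 t0; rewrite /powR !gt_eqF// -!expRD ler_expR.
have := @le_ln1Dx _ (t / b - 1).
rewrite [X in ln X]addrC subrK ltrBrDr addNr divr_gt0// => /(_ isT).
rewrite ln_div// -(ler_pM2l b0) mulrBr mulrBr mulr1 mulrCA divff ?gt_eqF//.
lra.
Qed.

Lemma inv4_continuous c t : 0 < t -> {for t, continuous (fun u : R => c / u ^+ 4)}.
Proof.
move=> t0; apply: (@is_derive_cvg _ _ _ (c * (- (4 * t ^+ 3 * 1) / (t ^+ 4) ^+ 2))).
by derive; rewrite ?expf_neq0 ?gt_eqF// mulr0 addr0.
Qed.

Lemma integral_inv4_itvcy c z : 0 < c -> 0 < z ->
  (\int[mu]_(t in `[z, +oo[) (c / t ^+ 4)%:E = (c / 3 / z ^+ 3)%:E)%E.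
Proof.
move=> c0 z0; pose F t := - (c / 3 / t ^+ 3).
have dF t : 0 < t -> is_derive t 1 F (c / t ^+ 4).
  move=> t0; rewrite /F; derive; first by rewrite expf_neq0 ?gt_eqF.
  by field; rewrite gt_eqF.
have f0 t : 0 < t -> 0 <= c / t ^+ 4.
  by move=> t0; rewrite divr_ge0 ?exprn_ge0 ?ltW.
have Fy : F t @[t --> +oo] --> (0 : R).
  apply: (@cvgy0_le_inv _ _ (c / 3)) => t t1; have t0 : 0 < t by lra.
  rewrite normrN ger0_norm.
    rewrite ler_pM2l ?divr_gt0//.
    by rewrite lef_pV2 ?posrE ?exprn_gt0// -[leLHS]expr1 ler_weXn2l.
  by rewrite divr_ge0 ?exprn_ge0 ?ltW// divr_gt0.
have := integral_itvcy_derive z0 (@inv4_continuous c) f0 dF Fy.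
by rewrite sub0r opprK.
Qed.

Variable a : R.
Hypothesis a0 : 0 < a.
Let p := gamma_density a.

Lemma is_derive_gamma_density t : 0 < t ->
  is_derive t 1 p (p t * ((a - 1) / t - 1)).
Proof.
move=> t0; have d := is_derive1_powR (a - 1) t0.
rewrite /p /gamma_density; derive.
have -> : t `^ (a - 1 - 1) = t `^ (a - 1) / t.
  by rewrite powRD ?(gt_eqF t0) ?implybT// powR_inv1 ?ltW.
ring.
Qed.

Let gamma_kernel t := t `^ (a - 1) * expR (- t).

Lemma gamma_densityE t : p t = (Gamma a)^-1 * gamma_kernel t.
Proof. by rewrite /p /gamma_density mulrA. Qed.

Lemma gamma_kernel_gt0 t : 0 < t -> 0 < gamma_kernel t.
Proof. by move=> t0; rewrite mulr_gt0 ?powR_gt0 ?expR_gt0. Qed.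

Lemma gamma_kernel_continuous t : 0 < t -> {for t, continuous gamma_kernel}.
Proof.
move=> t0; have d := is_derive1_powR (a - 1) t0.
apply: (@is_derive_cvg _ _ _ (t `^ (a - 1) * (- 1 * expR (- t)) +
  expR (- t) * ((a - 1) * t `^ (a - 1 - 1)))).
by rewrite /gamma_kernel; derive.
Qed.

Lemma gamma_kernel_le_powR t : 0 < t -> gamma_kernel t <= t `^ (a - 1).
Proof.
move=> t0; rewrite /gamma_kernel ler_piMr ?powR_ge0//.
by rewrite -expR0 ler_expR; lra.
Qed.

(** The maximum of [t ^ (a + 3) exp (- t)], so that the kernel is at most [C / t ^ 4]. The fourth
    power yields a tail of order [t ^ -3], enough to make [t ^ 2 Q] vanish at infinity. *)
Let C := (a + 3) `^ (a + 3) * expR (- (a + 3)).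

Let C_gt0 : 0 < C.
Proof. by rewrite mulr_gt0 ?expR_gt0 ?powR_gt0 ?addr_gt0. Qed.

Lemma gamma_kernel_le_inv t : 0 < t -> gamma_kernel t <= C / t ^+ 4.
Proof.
move=> t0; rewrite ler_pdivlMr ?exprn_gt0//.
have -> : gamma_kernel t * t ^+ 4 = t `^ (a + 3) * expR (- t).
  rewrite /gamma_kernel -powR_mulrn ?ltW// mulrAC -powRD ?(gt_eqF t0) ?implybT//.
  by congr (_ `^ _ * _); ring.
by apply: powR_expR_le => //; rewrite addr_gt0.
Qed.

Lemma integral_powR_itv0c z : 0 < z ->
  (\int[mu]_(t in `]0%R, z]) (t `^ (a - 1))%:E = (z `^ a / a)%:E)%E.
Proof.
move=> z0; rewrite -(subr0 (z `^ a / a)).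
apply: (@integral_itv0c_derive _ _ (fun t => t `^ a / a)) => //.
- by move=> t t0; apply: is_derive_cvg (is_derive1_powR (a - 1) t0).
- by move=> t _; exact: powR_ge0.
- move=> t t0; have d := is_derive1_powR a t0.
  by derive; rewrite ?mulr0 ?add0r mulrA mulVf ?mul1r ?gt_eqF.
- rewrite -[X in _ --> X](mul0r a^-1); apply: cvgM; last exact: cvg_cst.
  exact: powR_cvg0.
Qed.

(** The majorants are [t ^ (a - 1)] on []0, 1]] and [C / t ^ 4] on [[1, +oo[]. *)
Lemma gamma_kernel_integrable : mu.-integrable `]0, +oo[ (EFin \o gamma_kernel).
Proof.
have mk := continuous_measurable_itv0y gamma_kernel_continuous.
apply: (@integrable_itv0y _ _ (1 `^ a / a) (C / 3 / 1 ^+ 3)).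
- exact: gamma_kernel_continuous.
- by move=> t t0; exact/ltW/gamma_kernel_gt0.
- rewrite -integral_powR_itv0c//; apply: ge0_le_integral => //=.
  + by move=> t; rewrite in_itv/= => /andP[t0 _]; rewrite lee_fin ltW ?gamma_kernel_gt0.
  + apply/measurable_EFinP; apply: measurable_funS mk => //.
    by move=> t/=; rewrite !in_itv/= => /andP[->].
  + by apply/measurable_EFinP/measurable_funTS; exact: measurable_powR.
  + by move=> t; rewrite in_itv/= => /andP[t0 _]; rewrite lee_fin gamma_kernel_le_powR.
- rewrite -integral_inv4_itvcy//; apply: ge0_le_integral => //=.
  + move=> t; rewrite in_itv/= andbT => t1.
    by rewrite lee_fin ltW ?gamma_kernel_gt0//; exact: lt_le_trans t1.
  + apply/measurable_EFinP; apply: measurable_funS mk => //.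
    by move=> t/=; rewrite !in_itv/= !andbT; exact: lt_le_trans.
  + apply/measurable_EFinP.
    apply: measurable_funS (continuous_measurable_itv0y (@inv4_continuous C)) => //.
    by move=> t/=; rewrite !in_itv/= !andbT; exact: lt_le_trans.
  + move=> t; rewrite in_itv/= andbT => t1.
    by rewrite lee_fin gamma_kernel_le_inv//; exact: lt_le_trans t1.
Qed.

(** The distribution function before normalization; the positivity of [Gamma a] is deduced from
    it. *)
Let G z : R := \int[mu]_(t in `]0, z]) gamma_kernel t.

Let kernel_integrableS (A : set R) : measurable A -> A `<=` `]0, +oo[ ->
  mu.-integrable A (EFin \o gamma_kernel).
Proof. by move=> mA A0; exact: integrableS gamma_kernel_integrable. Qed.

Let is_derive_G z : 0 < z -> is_derive z 1 G (gamma_kernel z).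
Proof.
move=> z0; have [dG GE] : derivable G z 1 /\ G^`()%classic z = gamma_kernel z.
  apply: (@continuous_FTC1 R gamma_kernel (BRight 0) z (z + 1)).
  - by rewrite ltrDl.
  - apply: kernel_integrableS => // t /=.
    by rewrite !in_itv/= andbT => /andP[].
  - exact: z0.
  - exact: gamma_kernel_continuous.
by split; [exact: dG|rewrite -GE derive1E].
Qed.

Let G_le z : 0 < z -> G z <= z `^ a / a.
Proof.
move=> z0; have := integral_powR_itv0c z0 => E.
have <- : (\int[mu]_(t in `]0, z]) t `^ (a - 1))%R = z `^ a / a by rewrite /Rintegral E.
apply: le_Rintegral => //=.
- apply: kernel_integrableS => // t /=.
  by rewrite !in_itv/= andbT => /andP[].
- apply/integrableP; split.
    by apply/measurable_EFinP/measurable_funTS; exact: measurable_powR.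
  under eq_integral do rewrite /= ger0_norm ?powR_ge0//.
  by rewrite E ltry.
- by move=> t; rewrite in_itv/= => /andP[t0 _]; exact: gamma_kernel_le_powR.
Qed.

Let G_ge0 z : 0 <= G z.
Proof.
apply: Rintegral_ge0 => t /=; rewrite in_itv/= => /andP[t0 _].
exact/ltW/gamma_kernel_gt0.
Qed.

Let G_cvg0 : G z @[z --> (0 : R)^'+] --> (0 : R).
Proof.
apply: (@squeeze_cvgr _ _ _ _ (cst 0) (fun z => z `^ a / a)); last 2 first.
- exact: cvg_cst.
- rewrite -[X in _ --> X](mul0r a^-1); apply: cvgM; last exact: cvg_cst.
  exact: powR_cvg0.
by near=> z; rewrite G_ge0 G_le//; near: z; exact: nbhs_right_gt.
Unshelve. all: by end_near. Qed.

Let G_tail z : 0 < z ->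
  Gamma a - G z = \int[mu]_(t in `[z, +oo[) gamma_kernel t.
Proof.
move=> z0; rewrite -Rintegral_itv_obnd_cbnd; last first.
  apply: kernel_integrableS => // t /=.
  by rewrite !in_itv/= !andbT; exact: lt_trans.
rewrite -(@Rintegral_itvB _ _ (BRight 0) +oo%O z)//.
- exact: gamma_kernel_integrable.
- by rewrite bnd_simp ltW.
Qed.

Let G_tail_bounds z : 0 < z -> 0 <= Gamma a - G z <= C / 3 / z ^+ 3.
Proof.
move=> z0; rewrite G_tail//; apply/andP; split.
  apply: Rintegral_ge0 => t /=; rewrite in_itv/= andbT => zt.
  exact/ltW/gamma_kernel_gt0/(lt_le_trans z0 zt).
have E := integral_inv4_itvcy C_gt0 z0.
have <- : (\int[mu]_(t in `[z, +oo[) (C / t ^+ 4))%R = C / 3 / z ^+ 3 by rewrite /Rintegral E.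
apply: le_Rintegral => //=.
- apply: kernel_integrableS => // t /=.
  by rewrite !in_itv/= !andbT; exact: lt_le_trans.
- apply/integrableP; split.
    apply/measurable_EFinP.
    apply: measurable_funS (continuous_measurable_itv0y (@inv4_continuous C)) => //.
    by move=> t/=; rewrite !in_itv/= !andbT; exact: lt_le_trans.
  under eq_integral => t.
    rewrite inE/= in_itv/= andbT => zt.
    rewrite /= ger0_norm; last first.
      by rewrite divr_ge0 ?exprn_ge0 ?(ltW C_gt0)// ltW// (lt_le_trans z0).
    over.
  by rewrite E ltry.
- move=> t; rewrite in_itv/= andbT => zt; apply: gamma_kernel_le_inv.
  exact: lt_le_trans zt.
Qed.

(** [G] increases strictly from 0 and [Gamma a - G 1] is a nonnegative tail, so
    [0 < G 1 <= Gamma a]. *)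
Lemma Gamma_gt0 : 0 < Gamma a.
Proof.
have := is_derive_gt_lim0 ltr01 is_derive_G gamma_kernel_gt0 G_cvg0.
have /andP[+ _] := G_tail_bounds ltr01.
by rewrite subr_ge0 => /[swap]; exact: lt_le_trans.
Qed.

Lemma gamma_density_gt0 t : 0 < t -> 0 < p t.
Proof.
by move=> t0; rewrite gamma_densityE mulr_gt0 ?invr_gt0 ?Gamma_gt0 ?gamma_kernel_gt0.
Qed.

Let gamma_cdfE z : gamma_cdf a z = (Gamma a)^-1 * G z.
Proof.
rewrite /gamma_cdf; under eq_Rintegral do rewrite -/(p _) gamma_densityE.
rewrite RintegralZl//; apply: kernel_integrableS => // t /=.
by rewrite !in_itv/= andbT => /andP[].
Qed.

Lemma is_derive_gamma_cdf z : 0 < z -> is_derive z 1 (gamma_cdf a) (p z).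
Proof.
move=> z0; have d := is_derive_G z0.
rewrite (funext gamma_cdfE); derive.
by rewrite mulr0 addr0 gamma_densityE.
Qed.

Lemma gamma_cdf_cvg0 : gamma_cdf a z @[z --> (0 : R)^'+] --> (0 : R).
Proof.
rewrite (funext gamma_cdfE) -[X in _ --> X](mulr0 (Gamma a)^-1).
by apply: cvgM; [exact: cvg_cst|exact: G_cvg0].
Qed.

Lemma gamma_tailE z : 0 < z -> gamma_tail a z = 1 - gamma_cdf a z.
Proof.
move=> z0; rewrite gamma_cdfE.
rewrite -[X in X - _](@mulVf _ (Gamma a)) ?gt_eqF ?Gamma_gt0// -mulrBr G_tail//.
rewrite /gamma_tail; under eq_Rintegral do rewrite -/(p _) gamma_densityE.
rewrite RintegralZl//; apply: kernel_integrableS => // t /=.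
by rewrite !in_itv/= !andbT; exact: lt_le_trans.
Qed.

Lemma gamma_tail_bound : exists2 M, 0 < M &
  forall z, 0 < z -> 0 <= gamma_tail a z <= M / z ^+ 3.
Proof.
exists ((Gamma a)^-1 * (C / 3)).
  by rewrite mulr_gt0 ?divr_gt0 ?invr_gt0 ?Gamma_gt0 ?C_gt0.
move=> z z0; rewrite gamma_tailE// gamma_cdfE.
rewrite -[X in X - _](@mulVf _ (Gamma a)) ?gt_eqF ?Gamma_gt0// -mulrBr.
have /andP[h1 h2] := G_tail_bounds z0.
rewrite mulr_ge0 ?invr_ge0 ?(ltW Gamma_gt0)//= -mulrA ler_pM2l//.
by rewrite invr_gt0 Gamma_gt0.
Qed.

Lemma gamma_density_bound : exists2 M, 0 < M &
  forall z, 0 < z -> p z <= M / z ^+ 4.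
Proof.
exists ((Gamma a)^-1 * C).
  by rewrite mulr_gt0 ?invr_gt0 ?Gamma_gt0 ?C_gt0.
move=> z z0; rewrite gamma_densityE -mulrA ler_pM2l ?invr_gt0 ?Gamma_gt0//.
exact: gamma_kernel_le_inv.
Qed.

Lemma gamma_density_cvg0 : z * p z @[z --> (0 : R)^'+] --> (0 : R).
Proof.
apply: (@squeeze_cvgr _ _ _ _ (cst 0) (fun z => (Gamma a)^-1 * z `^ a)); last 2 first.
- exact: cvg_cst.
- rewrite -[X in _ --> X](mulr0 (Gamma a)^-1); apply: cvgM; first exact: cvg_cst.
  exact: powR_cvg0.
near=> z; have z0 : 0 < z by near: z; exact: nbhs_right_gt.
rewrite /= mulr_ge0 ?(ltW z0) ?(ltW (gamma_density_gt0 z0))//= gamma_densityE mulrCA.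
rewrite ler_pM2l ?invr_gt0 ?Gamma_gt0// -(@mulr_powRB1 _ z a) ?(ltW z0)//.
by rewrite ler_pM2l// gamma_kernel_le_powR.
Unshelve. all: by end_near. Qed.

End GammaKernel.

(** * Iterated integrals *)

Section PositiveHalfLine.
Context {R : realType}.
Implicit Types (f g : R -> R) (t z d l : R).

(** The closed forms below are equalities on the positive half-line only. As this set is open, they
    still determine derivatives there; the next two lemmas do the same for limits at its ends. *)
Lemma is_derive_eq_pos f g z d : (forall t, 0 < t -> f t = g t) -> 0 < z ->
  is_derive z 1 g d -> is_derive z 1 f d.
Proof.
move=> fg z0; apply: near_eq_is_derive.
by near=> t; apply/esym/fg; near: t; exact: lt_nbhsr.
Unshelve. all: by end_near. Qed.

Lemma cvg_eq_pos0 f g l : (forall t, 0 < t -> f t = g t) ->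
  g t @[t --> (0 : R)^'+] --> l -> f t @[t --> (0 : R)^'+] --> l.
Proof.
move=> fg; apply: cvg_trans; apply: near_eq_cvg.
by near=> t; apply/esym/fg; near: t; exact: nbhs_right_gt.
Unshelve. all: by end_near. Qed.

Lemma cvg_eq_posy f g l : (forall t, 0 < t -> f t = g t) ->
  g t @[t --> +oo] --> l -> f t @[t --> +oo] --> l.
Proof.
move=> fg; apply: cvg_trans; apply: near_eq_cvg.
by near=> t; apply/esym/fg; near: t; exact: nbhs_pinfty_gt (num_real _).
Unshelve. all: by end_near. Qed.

End PositiveHalfLine.

Section IteratedIntegrals.
Context {R : realType}.
Notation mu := (@lebesgue_measure R).
Implicit Types a t z : R.

Definition gamma_cdf2 a z : R := \int[mu]_(x in `]0, z]) gamma_cdf1 a x.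

Definition gamma_tail2 a z : R := \int[mu]_(x in `[z, +oo[) gamma_tail1 a x.

Local Notation p := gamma_density.
Local Notation P := gamma_cdf.
Local Notation Q := gamma_tail.

Lemma is_derive_gamma_tail a z : 0 < a -> 0 < z -> is_derive z 1 (Q a) (- p a z).
Proof.
move=> a0 z0; apply: (is_derive_eq_pos (gamma_tailE a0)) => //.
by have d := is_derive_gamma_cdf a0 z0; derive; rewrite add0r.
Qed.

Lemma gamma_cdf_ge0 a z : 0 < a -> 0 < z -> 0 <= P a z.
Proof.
move=> a0 z0; apply: (is_derive_ge_lim0 z0 (is_derive_gamma_cdf a0)).
  by move=> t t0; exact/ltW/gamma_density_gt0.
exact: gamma_cdf_cvg0.
Qed.

Lemma gamma_tail_ge0 a z : 0 < a -> 0 < z -> 0 <= Q a z.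
Proof. by move=> a0 z0; have [M _ /(_ _ z0)/andP[]] := gamma_tail_bound a0. Qed.

Lemma gamma_tail_cvgy a k : 0 < a -> (k <= 2)%N ->
  t ^+ k * Q a t @[t --> +oo] --> (0 : R).
Proof.
move=> a0 k2; have [M M0 QM] := gamma_tail_bound a0.
apply: (@cvgy0_le_inv _ _ M) => t t1; have t0 : 0 < t by lra.
have /andP[Q0 QMt] := QM _ t0.
rewrite ger0_norm ?mulr_ge0 ?exprn_ge0 ?(ltW t0)//.
apply: (@le_trans _ _ (t ^+ 2 * Q a t)).
  by rewrite ler_wpM2r// ler_weXn2l.
apply: (@le_trans _ _ (t ^+ 2 * (M / t ^+ 3))).
  by rewrite ler_wpM2l// exprn_ge0// ltW.
by rewrite le_eqVlt; apply/orP; left; apply/eqP; field; rewrite gt_eqF.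
Qed.

Lemma gamma_density_cvgy a k : 0 < a -> (k <= 3)%N ->
  t ^+ k * p a t @[t --> +oo] --> (0 : R).
Proof.
move=> a0 k3; have [M M0 pM] := gamma_density_bound a0.
apply: (@cvgy0_le_inv _ _ M) => t t1; have t0 : 0 < t by lra.
have p0 : 0 <= p a t by exact/ltW/gamma_density_gt0.
rewrite ger0_norm; last by apply: mulr_ge0 => //; rewrite exprn_ge0// ltW.
apply: (@le_trans _ _ (t ^+ 3 * p a t)).
  by rewrite ler_wpM2r// ler_weXn2l.
apply: (@le_trans _ _ (t ^+ 3 * (M / t ^+ 4))).
  by apply: ler_wpM2l; [rewrite exprn_ge0// ltW|exact: pM].
by rewrite le_eqVlt; apply/orP; left; apply/eqP; field; rewrite gt_eqF.
Qed.

(** The right-hand side vanishes at 0, and its derivative is [P], because [(z p)' = (a - z) p]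
    cancels the term [(z - a) p]. *)
Lemma gamma_cdf1E a z : 0 < a -> 0 < z ->
  gamma_cdf1 a z = (z - a) * P a z + z * p a z.
Proof.
move=> a0 z0.
have PC t : 0 < t -> {for t, continuous (P a)}.
  by move=> t0; exact: is_derive_cvg (is_derive_gamma_cdf a0 t0).
have dF t : 0 < t -> is_derive t 1 (fun t => (t - a) * P a t + t * p a t) (P a t).
  move=> t0; have dP := is_derive_gamma_cdf a0 t0.
  have dp := is_derive_gamma_density a t0.
  by derive; field; rewrite gt_eqF.
have F0 : (t - a) * P a t + t * p a t @[t --> (0 : R)^'+] --> (0 : R).
  rewrite -[X in _ --> X](addr0 0); apply: cvgD; last exact: gamma_density_cvg0.
  rewrite -[X in _ --> X](mulr0 (0 - a)); apply: cvgM; last exact: gamma_cdf_cvg0.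
  by apply: cvgB; [apply: cvg_at_right_filter; exact: cvg_id|exact: cvg_cst].
exact: (Rintegral_itv0c_derive z0 PC (fun t => @gamma_cdf_ge0 a t a0) dF F0).
Qed.

Lemma gamma_tail1_formula_cvgy a : 0 < a ->
  t * p a t - (t - a) * Q a t @[t --> +oo] --> (0 : R).
Proof.
move=> a0; have -> : (fun t => t * p a t - (t - a) * Q a t) =
  (fun t => t ^+ 1 * p a t - (t ^+ 1 * Q a t - a * (t ^+ 0 * Q a t))).
  by apply/funext => t; ring.
have -> : 0 = 0 - (0 - a * 0) :> R by ring.
apply: cvgB; first exact: gamma_density_cvgy.
apply: cvgB; first exact: gamma_tail_cvgy.
by apply: cvgM; [exact: cvg_cst|exact: gamma_tail_cvgy].
Qed.

Lemma gamma_tail1E a z : 0 < a -> 0 < z ->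
  gamma_tail1 a z = z * p a z - (z - a) * Q a z.
Proof.
move=> a0 z0.
have QC t : 0 < t -> {for t, continuous (Q a)}.
  by move=> t0; exact: is_derive_cvg (is_derive_gamma_tail a0 t0).
have dF t : 0 < t -> is_derive t 1 (fun t => t * p a t - (t - a) * Q a t) (- Q a t).
  move=> t0; have dQ := is_derive_gamma_tail a0 t0.
  have dp := is_derive_gamma_density a t0.
  by derive; field; rewrite gt_eqF.
exact: (Rintegral_itvcy_derive z0 QC (fun t => @gamma_tail_ge0 a t a0) dF
  (gamma_tail1_formula_cvgy a0)).
Qed.

Lemma is_derive_gamma_cdf1 a z : 0 < a -> 0 < z ->
  is_derive z 1 (gamma_cdf1 a) (P a z).
Proof.
move=> a0 z0; apply: (is_derive_eq_pos (fun t => @gamma_cdf1E a t a0)) => //.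
have dP := is_derive_gamma_cdf a0 z0; have dp := is_derive_gamma_density a z0.
by derive; field; rewrite gt_eqF.
Qed.

Lemma is_derive_gamma_tail1 a z : 0 < a -> 0 < z ->
  is_derive z 1 (gamma_tail1 a) (- Q a z).
Proof.
move=> a0 z0; apply: (is_derive_eq_pos (fun t => @gamma_tail1E a t a0)) => //.
have dQ := is_derive_gamma_tail a0 z0; have dp := is_derive_gamma_density a z0.
by derive; field; rewrite gt_eqF.
Qed.

Lemma gamma_cdf1_ge0 a z : 0 < a -> 0 <= gamma_cdf1 a z.
Proof.
move=> a0; apply: Rintegral_ge0 => t /=; rewrite in_itv/= => /andP[t0 _].
exact: gamma_cdf_ge0.
Qed.

Lemma gamma_tail1_ge0 a z : 0 < a -> 0 < z -> 0 <= gamma_tail1 a z.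
Proof.
move=> a0 z0; apply: Rintegral_ge0 => t /=; rewrite in_itv/= andbT => zt.
by apply: gamma_tail_ge0 => //; exact: lt_le_trans zt.
Qed.

Lemma gamma_cdf1_cvg0 a : 0 < a -> gamma_cdf1 a z @[z --> (0 : R)^'+] --> (0 : R).
Proof.
move=> a0; apply: (cvg_eq_pos0 (fun t => @gamma_cdf1E a t a0)).
rewrite -[X in _ --> X](addr0 0); apply: cvgD; last exact: gamma_density_cvg0.
rewrite -[X in _ --> X](mulr0 (0 - a)); apply: cvgM; last exact: gamma_cdf_cvg0.
by apply: cvgB; [apply: cvg_at_right_filter; exact: cvg_id|exact: cvg_cst].
Qed.

Lemma gamma_cdf2_formula_cvg0 a : 0 < a ->
  (((z - a) ^+ 2 + a) * P a z + (z - a - 1) * (z * p a z)) / 2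
    @[z --> (0 : R)^'+] --> (0 : R).
Proof.
move=> a0; have id0 : z @[z --> (0 : R)^'+] --> (0 : R).
  by apply: cvg_at_right_filter; exact: cvg_id.
rewrite [X in _ --> X](_ : 0 = (((0 - a) ^+ 2 + a) * 0 + (0 - a - 1) * 0) / 2 :> R);
  last by ring.
apply: cvgM; last exact: cvg_cst.
apply: cvgD.
  apply: cvgM; last exact: gamma_cdf_cvg0.
  apply: cvgD; last exact: cvg_cst.
  by apply: cvgM; apply: cvgB => //; exact: cvg_cst.
apply: cvgM; last exact: gamma_density_cvg0.
by apply: cvgB; [apply: cvgB => //; exact: cvg_cst|exact: cvg_cst].
Qed.

(** In the derivative the multiples of [p] add up to [(a + (z - a)) p = z p], which leaves twice the
    closed form of [gamma_cdf1]. *)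
Lemma gamma_cdf2E a z : 0 < a -> 0 < z -> gamma_cdf2 a z =
  (((z - a) ^+ 2 + a) * P a z + (z - a - 1) * (z * p a z)) / 2.
Proof.
move=> a0 z0.
have PC t : 0 < t -> {for t, continuous (gamma_cdf1 a)}.
  by move=> t0; exact: is_derive_cvg (is_derive_gamma_cdf1 a0 t0).
have dF t : 0 < t -> is_derive t 1
    (fun t => (((t - a) ^+ 2 + a) * P a t + (t - a - 1) * (t * p a t)) / 2)
    (gamma_cdf1 a t).
  move=> t0; have dP := is_derive_gamma_cdf a0 t0.
  have dp := is_derive_gamma_density a t0.
  by derive; rewrite gamma_cdf1E//; field; rewrite gt_eqF.
exact: (Rintegral_itv0c_derive z0 PC (fun t _ => @gamma_cdf1_ge0 a t a0) dF
  (gamma_cdf2_formula_cvg0 a0)).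
Qed.

Lemma gamma_tail2_formula_cvgy a : 0 < a ->
  (((z - a) ^+ 2 + a) * Q a z - (z - a - 1) * (z * p a z)) / 2
    @[z --> +oo] --> (0 : R).
Proof.
move=> a0.
have -> : (fun z => (((z - a) ^+ 2 + a) * Q a z - (z - a - 1) * (z * p a z)) / 2) =
  (fun z => (z ^+ 2 * Q a z + (- (2 * a)) * (z ^+ 1 * Q a z) +
     (a ^+ 2 + a) * (z ^+ 0 * Q a z) - (z ^+ 2 * p a z) +
     (a + 1) * (z ^+ 1 * p a z)) / 2).
  by apply/funext => z; ring.
have -> : 0 = (0 + (- (2 * a)) * 0 + (a ^+ 2 + a) * 0 - 0 + (a + 1) * 0) / 2 :> R.
  by ring.
apply: cvgM; last exact: cvg_cst.
apply: cvgD; last by apply: cvgM; [exact: cvg_cst|exact: gamma_density_cvgy].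
apply: cvgB; last exact: gamma_density_cvgy.
apply: cvgD; last by apply: cvgM; [exact: cvg_cst|exact: gamma_tail_cvgy].
apply: cvgD; last by apply: cvgM; [exact: cvg_cst|exact: gamma_tail_cvgy].
exact: gamma_tail_cvgy.
Qed.

Lemma gamma_tail2E a z : 0 < a -> 0 < z -> gamma_tail2 a z =
  (((z - a) ^+ 2 + a) * Q a z - (z - a - 1) * (z * p a z)) / 2.
Proof.
move=> a0 z0.
have QC t : 0 < t -> {for t, continuous (gamma_tail1 a)}.
  by move=> t0; exact: is_derive_cvg (is_derive_gamma_tail1 a0 t0).
have dF t : 0 < t -> is_derive t 1
    (fun t => (((t - a) ^+ 2 + a) * Q a t - (t - a - 1) * (t * p a t)) / 2)
    (- gamma_tail1 a t).
  move=> t0; have dQ := is_derive_gamma_tail a0 t0.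
  have dp := is_derive_gamma_density a t0.
  by derive; rewrite gamma_tail1E//; field; rewrite gt_eqF.
exact: (Rintegral_itvcy_derive z0 QC (fun t => @gamma_tail1_ge0 a t a0) dF
  (gamma_tail2_formula_cvgy a0)).
Qed.

Lemma gamma_cdf2_ge0 a z : 0 < a -> 0 <= gamma_cdf2 a z.
Proof. by move=> a0; apply: Rintegral_ge0 => t _; exact: gamma_cdf1_ge0. Qed.

Lemma gamma_tail2_ge0 a z : 0 < a -> 0 < z -> 0 <= gamma_tail2 a z.
Proof.
move=> a0 z0; apply: Rintegral_ge0 => t /=; rewrite in_itv/= andbT => zt.
by apply: gamma_tail1_ge0 => //; exact: lt_le_trans zt.
Qed.

Lemma C2_def a z : C2 a z =
  (upper_M a)^`(2)%classic z * gamma_cdf2 a z +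
  (lower_M a)^`(2)%classic z * gamma_tail2 a z.
Proof. by []. Qed.

End IteratedIntegrals.

#[local] Opaque gamma_density gamma_cdf gamma_tail gamma_cdf1 gamma_tail1 gamma_cdf2
  gamma_tail2.

(** * Closed forms of the coefficients and bounds for fixed [a] *)

Section Coefficients.
Context {R : realType}.
Implicit Types a t z : R.

Local Notation p := gamma_density.
Local Notation P := gamma_cdf.
Local Notation Q := gamma_tail.
Local Notation P1 := gamma_cdf1.
Local Notation Q1 := gamma_tail1.
Local Notation P2 := gamma_cdf2.
Local Notation Q2 := gamma_tail2.

Lemma is_derive_gamma_cdf2 a z : 0 < a -> 0 < z -> is_derive z 1 (P2 a) (P1 a z).
Proof.
move=> a0 z0; apply: (is_derive_eq_pos (fun t => @gamma_cdf2E _ a t a0) z0).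
have dP := is_derive_gamma_cdf a0 z0; have dp := is_derive_gamma_density a z0.
by derive; rewrite gamma_cdf1E//; field; rewrite gt_eqF.
Qed.

Lemma is_derive_gamma_tail2 a z : 0 < a -> 0 < z ->
  is_derive z 1 (Q2 a) (- Q1 a z).
Proof.
move=> a0 z0; apply: (is_derive_eq_pos (fun t => @gamma_tail2E _ a t a0) z0).
have dQ := is_derive_gamma_tail a0 z0; have dp := is_derive_gamma_density a z0.
by derive; rewrite gamma_tail1E//; field; rewrite gt_eqF.
Qed.

Lemma gamma_cdf2_cvg0 a : 0 < a -> P2 a z @[z --> (0 : R)^'+] --> (0 : R).
Proof.
move=> a0; apply: (cvg_eq_pos0 (fun t => @gamma_cdf2E _ a t a0)).
exact: gamma_cdf2_formula_cvg0.
Qed.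

Lemma gamma_cdf1_le a z : 0 < a -> 0 < z -> P1 a z <= z * P a z.
Proof.
move=> a0 z0; rewrite -subr_ge0.
apply: (@is_derive_ge_lim0 _ (fun t => t * P a t - P1 a t) (fun t => t * p a t)) => //.
- move=> t t0; have d := is_derive_gamma_cdf a0 t0.
  by have d1 := is_derive_gamma_cdf1 a0 t0; derive; ring.
- by move=> t t0; apply: mulr_ge0; [exact: ltW|exact/ltW/gamma_density_gt0].
- rewrite [X in _ --> X](_ : 0 = 0 * 0 - 0 :> R); last by ring.
  apply: cvgB; last exact: gamma_cdf1_cvg0.
  apply: cvgM; last exact: gamma_cdf_cvg0.
  by apply: cvg_at_right_filter; exact: cvg_id.
Qed.

Lemma gamma_cdf2_le a z : 0 < a -> 0 < z -> P2 a z <= z * P1 a z.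
Proof.
move=> a0 z0; rewrite -subr_ge0.
apply: (@is_derive_ge_lim0 _ (fun t => t * P1 a t - P2 a t) (fun t => t * P a t)) => //.
- move=> t t0; have d := is_derive_gamma_cdf1 a0 t0.
  by have d1 := is_derive_gamma_cdf2 a0 t0; derive; ring.
- by move=> t t0; apply: mulr_ge0; [exact: ltW|exact: gamma_cdf_ge0].
- rewrite [X in _ --> X](_ : 0 = 0 * 0 - 0 :> R); last by ring.
  apply: cvgB; last exact: gamma_cdf2_cvg0.
  apply: cvgM; last exact: gamma_cdf1_cvg0.
  by apply: cvg_at_right_filter; exact: cvg_id.
Qed.

(** In the closed forms the two terms [(z - a) P Q] cancel, and [P + Q = 1]. *)
Lemma gamma_wronskian1 a z : 0 < a -> 0 < z ->
  P a z * Q1 a z + Q a z * P1 a z = z * p a z.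
Proof.
by move=> a0 z0; rewrite gamma_cdf1E// gamma_tail1E// gamma_tailE//; ring.
Qed.

(** With [s = z - a] and [q = z p], the terms in [P Q] and [q ^ 2] cancel; what remains is
    [(s ^ 2 + a - s (s - 1)) q / 2 = z q / 2]. *)
Lemma gamma_wronskian2 a z : 0 < a -> 0 < z ->
  P1 a z * Q2 a z + Q1 a z * P2 a z = z * (z * p a z) / 2.
Proof.
move=> a0 z0; rewrite gamma_cdf2E// gamma_tail2E// gamma_cdf1E// gamma_tail1E//.
by rewrite gamma_tailE//; field.
Qed.

Lemma is_derive_lower_M a z : 0 < a -> 0 < z ->
  is_derive z 1 (lower_M a) (P1 a z / (z * (z * p a z))).
Proof.
move=> a0 z0; have d := is_derive_gamma_cdf a0 z0.
have dp := is_derive_gamma_density a z0.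
have p0 := gamma_density_gt0 a0 z0.
rewrite /lower_M; derive; first by rewrite mulf_neq0 ?gt_eqF.
by rewrite gamma_cdf1E//; field; rewrite !gt_eqF.
Qed.

Lemma is_derive_upper_M a z : 0 < a -> 0 < z ->
  is_derive z 1 (upper_M a) (- (Q1 a z / (z * (z * p a z)))).
Proof.
move=> a0 z0; have d := is_derive_gamma_tail a0 z0.
have dp := is_derive_gamma_density a z0.
have p0 := gamma_density_gt0 a0 z0.
rewrite /upper_M; derive; first by rewrite mulf_neq0 ?gt_eqF.
by rewrite gamma_tail1E//; field; rewrite !gt_eqF.
Qed.

(** Differentiating [P1 / (z q)] with [(z q)' = (1 + a - z) q] gives the numerator
    [z P + (z - a - 1) P1], which equals [2 P2]. *)
Lemma lower_M_derive2 a z : 0 < a -> 0 < z ->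
  (lower_M a)^`(2)%classic z = 2 * P2 a z / (z ^+ 2 * (z * p a z)).
Proof.
move=> a0 z0; rewrite derive1nS derive1n1; apply: is_derive1E.
have E t : 0 < t -> (lower_M a)^`()%classic t = P1 a t / (t * (t * p a t)).
  by move=> t0; exact: is_derive1E (is_derive_lower_M a0 t0).
apply: (is_derive_eq_pos E z0).
have d := is_derive_gamma_cdf1 a0 z0.
have dp := is_derive_gamma_density a z0.
have p0 := gamma_density_gt0 a0 z0.
derive; first by rewrite gt_eqF //; do 2 apply: mulr_gt0 => //.
by rewrite gamma_cdf2E// gamma_cdf1E//; field; rewrite !gt_eqF.
Qed.

Lemma upper_M_derive2 a z : 0 < a -> 0 < z ->
  (upper_M a)^`(2)%classic z = 2 * Q2 a z / (z ^+ 2 * (z * p a z)).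
Proof.
move=> a0 z0; rewrite derive1nS derive1n1; apply: is_derive1E.
have E t : 0 < t -> (upper_M a)^`()%classic t = - (Q1 a t / (t * (t * p a t))).
  by move=> t0; exact: is_derive1E (is_derive_upper_M a0 t0).
apply: (is_derive_eq_pos E z0).
have d := is_derive_gamma_tail1 a0 z0.
have dp := is_derive_gamma_density a z0.
have p0 := gamma_density_gt0 a0 z0.
derive; first by rewrite gt_eqF //; do 2 apply: mulr_gt0 => //.
by rewrite gamma_tail2E// gamma_tail1E//; field; rewrite !gt_eqF.
Qed.

Lemma C1E a z : 0 < a -> 0 < z ->
  C1 a z = 2 * (P1 a z * Q1 a z) / (z * (z * p a z)).
Proof.
move=> a0 z0; have p0 := gamma_density_gt0 a0 z0.
rewrite /C1 (is_derive1E (is_derive_upper_M a0 z0)).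
rewrite (is_derive1E (is_derive_lower_M a0 z0)).
by field; rewrite !gt_eqF.
Qed.

Lemma C2E a z : 0 < a -> 0 < z ->
  C2 a z = 4 * (P2 a z * Q2 a z) / (z ^+ 2 * (z * p a z)).
Proof.
move=> a0 z0; have p0 := gamma_density_gt0 a0 z0.
rewrite C2_def lower_M_derive2// upper_M_derive2//.
by field; rewrite !gt_eqF.
Qed.

Lemma C1_ge0 a z : 0 < a -> 0 < z -> 0 <= C1 a z.
Proof.
move=> a0 z0; rewrite C1E//; have p0 := gamma_density_gt0 a0 z0.
have h1 := gamma_cdf1_ge0 z a0; have h2 := gamma_tail1_ge0 a0 z0.
have q0 : 0 < z * (z * p a z) by do 2 apply: mulr_gt0 => //.
apply: divr_ge0; last exact: ltW.
by rewrite pmulr_rge0//; exact: (mulr_ge0 h1 h2).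
Qed.

Lemma C2_ge0 a z : 0 < a -> 0 < z -> 0 <= C2 a z.
Proof.
move=> a0 z0; rewrite C2E//; have p0 := gamma_density_gt0 a0 z0.
have h1 := gamma_cdf2_ge0 z a0; have h2 := gamma_tail2_ge0 a0 z0.
have q0 : 0 < z ^+ 2 * (z * p a z) by do 2 apply: mulr_gt0 => //.
apply: divr_ge0; last exact: ltW.
by rewrite pmulr_rge0//; exact: (mulr_ge0 h1 h2).
Qed.

(** Common core of the bounds by 2: replace [u1] by [z u], then add the nonnegative [z v u1] to
    complete the Wronskian. *)
Lemma mulr_le_wronskian z (u u1 v v1 : R) : 0 < z -> 0 <= u1 -> 0 <= v ->
  0 <= v1 -> u1 <= z * u -> u1 * v1 <= z * (u * v1 + v * u1).
Proof.
move=> z0 u10 v0 v10 u1u; apply: (le_trans (ler_wpM2r v10 u1u)).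
by rewrite -mulrA ler_pM2l// lerDl mulr_ge0.
Qed.

Lemma C1_le2 a z : 0 < a -> 0 < z -> C1 a z <= 2.
Proof.
move=> a0 z0; rewrite C1E//; have p0 := gamma_density_gt0 a0 z0.
have q0 : 0 < z * p a z by apply: mulr_gt0.
rewrite ler_pdivrMr; last exact: mulr_gt0.
rewrite ler_pM2l// -gamma_wronskian1//.
exact: (mulr_le_wronskian z0 (gamma_cdf1_ge0 z a0) (gamma_tail_ge0 a0 z0)
  (gamma_tail1_ge0 a0 z0) (gamma_cdf1_le a0 z0)).
Qed.

Lemma C2_le2 a z : 0 < a -> 0 < z -> C2 a z <= 2.
Proof.
move=> a0 z0; rewrite C2E//; have p0 := gamma_density_gt0 a0 z0.
have q0 : 0 < z * p a z by apply: mulr_gt0.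
rewrite ler_pdivrMr; last by apply: mulr_gt0 => //; rewrite exprn_gt0.
have : P2 a z * Q2 a z <= z * (z * (z * p a z) / 2).
  rewrite -gamma_wronskian2//.
  exact: (mulr_le_wronskian z0 (gamma_cdf2_ge0 z a0) (gamma_tail1_ge0 a0 z0)
    (gamma_tail2_ge0 a0 z0) (gamma_cdf2_le a0 z0)).
lra.
Qed.

(** For [z <= a] the bound [C1 <= 2] is enough. For [z > a] the decay of [Q1] must compensate the
    growth of [z P1 <= z ^ 2]. *)
Lemma mulr_C1_le a z : 0 < a -> 0 < z -> z * C1 a z <= 2 * (1 + a).
Proof.
move=> a0 z0; have [za|az] := leP z a.
  apply: (@le_trans _ _ (a * 2)); last lra.
  by apply: ler_pM => //; [exact: ltW|exact: C1_ge0|exact: C1_le2].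
have p0 := gamma_density_gt0 a0 z0.
have q0 : 0 < z * p a z by apply: mulr_gt0.
(* This is [Q2 >= 0] multiplied by [z - a], which is positive in this case. *)
have Q1le : ((z - a) ^+ 2 + a) * Q1 a z <= z * (z * p a z).
  have := gamma_tail2_ge0 a0 z0; rewrite gamma_tail2E// gamma_tail1E//.
  by move: (Q a z) (z * p a z) q0 => x q q0 h; nra.
have P1le : P1 a z <= z.
  apply: (le_trans (gamma_cdf1_le a0 z0)); rewrite ger_pMr//.
  by have := gamma_tail_ge0 a0 z0; rewrite gamma_tailE// subr_ge0.
have Q10 := gamma_tail1_ge0 a0 z0; have P10 := gamma_cdf1_ge0 z a0.
rewrite C1E//.
have -> : z * (2 * (P1 a z * Q1 a z) / (z * (z * p a z))) =
    2 * (P1 a z * Q1 a z) / (z * p a z).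
  by field; rewrite !gt_eqF.
rewrite ler_pdivrMr// -mulrA ler_pM2l//.
have D0 : 0 < (z - a) ^+ 2 + a by rewrite ltr_wpDl ?sqr_ge0.
rewrite -(ler_pM2l D0) mulrCA.
move: (P1 a z) (Q1 a z) (z * p a z) q0 P10 Q10 P1le Q1le => u v q q0 u0 v0 uz vq.
apply: (@le_trans _ _ (z * (z * q))).
  by apply: ler_pM => //; apply: mulr_ge0 => //; exact: ltW.
(* The remaining claim is the Cauchy-Schwarz inequality for [z = (z - a) + a], with an explicit
   square as defect. *)
rewrite !(mulrA _ _ q) ler_pM2r// -subr_ge0.
have -> : ((z - a) ^+ 2 + a) * (1 + a) - z * z = (z - a - 1) ^+ 2 * a.
  by ring.
by rewrite mulr_ge0 ?sqr_ge0 ?ltW.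
Qed.

End Coefficients.

(** * Log-concavity *)

Section LogConcavity.
Context {R : realType}.
Implicit Types (F G H k : R -> R) (z t s c x : R).

(** Log-concavity passes from [G] to its primitive [F]: the function [G ^ 2 / H - F] has derivative
    [G (H ^ 2 - G k) / H ^ 2 >= 0], and near 0 it is at least [- F], which tends to 0. *)
Lemma logconcave_primitive0 F G H k z : 0 < z ->
  (forall t, 0 < t -> is_derive t 1 F (G t)) ->
  (forall t, 0 < t -> is_derive t 1 G (H t)) ->
  (forall t, 0 < t -> is_derive t 1 H (k t)) ->
  (forall t, 0 < t -> 0 < H t) -> (forall t, 0 < t -> 0 <= G t) ->
  (forall t, 0 < t -> G t * k t <= H t ^+ 2) ->
  F t @[t --> (0 : R)^'+] --> (0 : R) -> F z * H z <= G z ^+ 2.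
Proof.
move=> z0 dF dG dH H0 G0 GkH Fl; rewrite -ler_pdivlMr ?H0// -subr_ge0.
pose f t := G t ^+ 2 / H t - F t.
have f_incr x y : 0 < x -> x <= y -> f x <= f y.
  move=> x0 xy.
  apply: (@is_derive_le _ _ (fun t => G t / H t ^+ 2 * (H t ^+ 2 - G t * k t)) _ _ xy).
    move=> t /andP[xt _]; have t0 : 0 < t by exact: lt_le_trans xt.
    have dFt := dF _ t0; have dGt := dG _ t0; have dHt := dH _ t0.
    rewrite /f; derive; first by rewrite gt_eqF ?H0.
    by field; rewrite gt_eqF ?H0.
  move=> t /andP[xt _]; have t0 : 0 < t by exact: lt_trans xt.
  by rewrite mulr_ge0 ?subr_ge0 ?GkH// divr_ge0 ?G0// sqr_ge0.
have NFl : - F t @[t --> (0 : R)^'+] --> (0 : R).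
  by rewrite -[X in _ --> X]oppr0; exact: cvgN.
apply: (cvgr_to_le NFl); near=> t.
have t0 : 0 < t by near: t; exact: nbhs_right_gt.
have tz : t <= z by near: t; exact: nbhs_right_le.
apply: le_trans (f_incr _ _ t0 tz).
by rewrite /f lerDr divr_ge0 ?sqr_ge0// ltW ?H0.
Unshelve. all: by end_near. Qed.

(** Mirror image for tails, where every integration changes the sign of the derivative; now
    [F - G ^ 2 / H] increases and is at most [F] near infinity. *)
Lemma logconcave_primitivey F G H k z : 0 < z ->
  (forall t, 0 < t -> is_derive t 1 F (- G t)) ->
  (forall t, 0 < t -> is_derive t 1 G (- H t)) ->
  (forall t, 0 < t -> is_derive t 1 H (k t)) ->
  (forall t, 0 < t -> 0 < H t) -> (forall t, 0 < t -> 0 <= G t) ->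
  (forall t, 0 < t -> - (G t * k t) <= H t ^+ 2) ->
  F t @[t --> +oo] --> (0 : R) -> F z * H z <= G z ^+ 2.
Proof.
move=> z0 dF dG dH H0 G0 GkH Fl; rewrite -ler_pdivlMr ?H0// -subr_ge0.
pose f t := F t - G t ^+ 2 / H t.
have f_incr x y : 0 < x -> x <= y -> f x <= f y.
  move=> x0 xy.
  apply: (@is_derive_le _ _ (fun t => G t / H t ^+ 2 * (H t ^+ 2 + G t * k t)) _ _ xy).
    move=> t /andP[xt _]; have t0 : 0 < t by exact: lt_le_trans xt.
    have dFt := dF _ t0; have dGt := dG _ t0; have dHt := dH _ t0.
    rewrite /f; derive; first by rewrite gt_eqF ?H0.
    by field; rewrite gt_eqF ?H0.
  move=> t /andP[xt _]; have t0 : 0 < t by exact: lt_trans xt.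
  rewrite mulr_ge0//; last by rewrite -lerBlDr sub0r GkH.
  by rewrite divr_ge0 ?G0// sqr_ge0.
have NFl : - F t @[t --> +oo] --> (0 : R).
  by rewrite -[X in _ --> X]oppr0; exact: cvgN.
apply: (cvgr_to_le NFl); near=> t.
have zt : z <= t by near: t; exact: nbhs_pinfty_ge (num_real _).
have t0 : 0 < t by exact: lt_le_trans zt.
rewrite -lerN2 opprK opprB; apply: (le_trans (f_incr _ _ z0 zt)).
by rewrite /f gerBl divr_ge0 ?sqr_ge0// ltW ?H0.
Unshelve. all: by end_near. Qed.

(* A Riccati inequality for a logarithmic derivative [x], solved for [x]. *)
Lemma sqrt_le_quadratic z x s c : 0 < z -> 0 < x -> 0 < c ->
  c <= z * x ^+ 2 + s * x -> Num.sqrt (s ^+ 2 + 4 * c * z) <= 2 * z * x + s.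
Proof.
move=> z0 x0 c0 h; have h0 : 0 <= 2 * z * x + s.
  rewrite leNgt; apply/negP => lt0.
  have : z * x + s < 0 by have := mulr_gt0 z0 x0; nra.
  nra.
rewrite -(ger0_norm h0) -sqrtr_sqr ler_wsqrtr//; nra.
Qed.

End LogConcavity.

(** * Bounds on the coefficients from log-concavity *)

Section OuterBounds.
Context {R : realType}.
Implicit Types a t z : R.

Local Notation p := gamma_density.
Local Notation P := gamma_cdf.
Local Notation Q := gamma_tail.
Local Notation P1 := gamma_cdf1.
Local Notation Q1 := gamma_tail1.
Local Notation P2 := gamma_cdf2.
Local Notation Q2 := gamma_tail2.

Lemma gamma_cdf_gt0 a z : 0 < a -> 0 < z -> 0 < P a z.
Proof.
move=> a0 z0; exact: (is_derive_gt_lim0 z0 (fun t => @is_derive_gamma_cdf _ a a0 t)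
  (@gamma_density_gt0 _ a a0) (gamma_cdf_cvg0 a0)).
Qed.

Lemma gamma_cdf1_gt0 a z : 0 < a -> 0 < z -> 0 < P1 a z.
Proof.
move=> a0 z0; apply: (is_derive_gt_lim0 z0 (fun t => @is_derive_gamma_cdf1 _ a t a0)).
  by move=> t; exact: gamma_cdf_gt0.
exact: gamma_cdf1_cvg0.
Qed.

Lemma gamma_cdf2_gt0 a z : 0 < a -> 0 < z -> 0 < P2 a z.
Proof.
move=> a0 z0; apply: (is_derive_gt_lim0 z0 (fun t => @is_derive_gamma_cdf2 _ a t a0)).
  by move=> t; exact: gamma_cdf1_gt0.
exact: gamma_cdf2_cvg0.
Qed.

Lemma gamma_tail_cvgy0 a : 0 < a -> Q a t @[t --> +oo] --> (0 : R).
Proof.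
move=> a0; have := @gamma_tail_cvgy _ a 0 a0 isT.
by under eq_fun do rewrite expr0 mul1r.
Qed.

Lemma gamma_tail1_cvgy a : 0 < a -> Q1 a t @[t --> +oo] --> (0 : R).
Proof.
move=> a0; apply: (cvg_eq_posy (fun t => @gamma_tail1E _ a t a0)).
exact: gamma_tail1_formula_cvgy.
Qed.

Lemma gamma_tail2_cvgy a : 0 < a -> Q2 a t @[t --> +oo] --> (0 : R).
Proof.
move=> a0; apply: (cvg_eq_posy (fun t => @gamma_tail2E _ a t a0)).
exact: gamma_tail2_formula_cvgy.
Qed.

Lemma gamma_tail_gt0 a z : 0 < a -> 0 < z -> 0 < Q a z.
Proof.
move=> a0 z0; apply: (is_derive_gt_limy z0 (fun t => @is_derive_gamma_tail _ a t a0)).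
  by move=> t t0; rewrite oppr_lt0; exact: gamma_density_gt0.
exact: gamma_tail_cvgy0.
Qed.

Lemma gamma_tail1_gt0 a z : 0 < a -> 0 < z -> 0 < Q1 a z.
Proof.
move=> a0 z0; apply: (is_derive_gt_limy z0 (fun t => @is_derive_gamma_tail1 _ a t a0)).
  by move=> t t0; rewrite oppr_lt0; exact: gamma_tail_gt0.
exact: gamma_tail1_cvgy.
Qed.

Lemma gamma_tail2_gt0 a z : 0 < a -> 0 < z -> 0 < Q2 a z.
Proof.
move=> a0 z0; apply: (is_derive_gt_limy z0 (fun t => @is_derive_gamma_tail2 _ a t a0)).
  by move=> t t0; rewrite oppr_lt0; exact: gamma_tail1_gt0.
exact: gamma_tail2_cvgy.
Qed.

(** Start of the log-concavity chain: multiplied by [p] it reads [P p' <= p ^ 2]. After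
    multiplication by [z], the difference of the two sides vanishes at 0 and has derivative
    [p + P]. *)
Lemma gamma_cdf_logderiv a z : 0 < a -> 0 < z ->
  P a z * ((a - 1) / z - 1) <= p a z.
Proof.
move=> a0 z0; rewrite -(ler_pM2l z0) -subr_ge0.
have -> : z * p a z - z * (P a z * ((a - 1) / z - 1)) =
    z * p a z - P a z * (a - 1 - z).
  by field; rewrite gt_eqF.
apply: (@is_derive_ge_lim0 _ (fun t => t * p a t - P a t * (a - 1 - t))
  (fun t => p a t + P a t)) => //.
- move=> t t0; have d := is_derive_gamma_cdf a0 t0.
  by have dp := is_derive_gamma_density a t0; derive; field; rewrite gt_eqF.
- by move=> t t0; rewrite addr_ge0 ?gamma_cdf_ge0// ltW// gamma_density_gt0.
- rewrite [X in _ --> X](_ : 0 = 0 - 0 * (a - 1 - 0) :> R); last by ring.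
  apply: cvgB; first exact: gamma_density_cvg0.
  apply: cvgM; first exact: gamma_cdf_cvg0.
  by apply: cvgB; [exact: cvg_cst|apply: cvg_at_right_filter; exact: cvg_id].
Qed.

(** The difference tends to 0 at infinity and has derivative [- Q (a - 1) / t ^ 2], which is
    nonpositive because [a >= 1]. *)
Lemma gamma_tail_logderiv a z : 1 <= a -> 0 < z ->
  - (Q a z * ((a - 1) / z - 1)) <= p a z.
Proof.
move=> a1 z0; have a0 : 0 < a by lra.
rewrite -subr_ge0 opprK.
apply: (@is_derive_ge_limy _ (fun t => p a t + Q a t * ((a - 1) / t - 1))
  (fun t => - (Q a t * (a - 1) / t ^+ 2))) => //.
- move=> t t0; have d := is_derive_gamma_tail a0 t0.
  have dp := is_derive_gamma_density a t0; derive; first by rewrite gt_eqF.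
  by field; rewrite gt_eqF.
- move=> t t0; rewrite oppr_le0 divr_ge0 ?sqr_ge0// mulr_ge0 ?gamma_tail_ge0//.
  lra.
- rewrite [X in _ --> X](_ : 0 = 0 + 0 * ((a - 1) * 0 - 1) :> R); last by ring.
  apply: cvgD.
    have := @gamma_density_cvgy _ a 0 a0 isT.
    by under eq_fun do rewrite expr0 mul1r.
  apply: cvgM; first exact: gamma_tail_cvgy0.
  apply: cvgB; last exact: cvg_cst.
  apply: cvgM; first exact: cvg_cst.
  apply: (@cvgy0_le_inv _ _ 1) => t t1.
  by rewrite mul1r ger0_norm// invr_ge0; lra.
Qed.

Lemma gamma_cdf1_logconcave a z : 0 < a -> 0 < z -> P1 a z * p a z <= P a z ^+ 2.
Proof.
move=> a0 z0.
apply: (logconcave_primitive0 z0 (fun t => @is_derive_gamma_cdf1 _ a t a0)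
  (fun t => @is_derive_gamma_cdf _ a a0 t) (fun t => @is_derive_gamma_density _ a t)).
- by move=> t; exact: gamma_density_gt0.
- by move=> t; exact: gamma_cdf_ge0.
- move=> t t0; rewrite mulrCA expr2 ler_pM2l ?gamma_density_gt0//.
  exact: gamma_cdf_logderiv.
- exact: gamma_cdf1_cvg0.
Qed.

Lemma gamma_cdf2_logconcave a z : 0 < a -> 0 < z -> P2 a z * P a z <= P1 a z ^+ 2.
Proof.
move=> a0 z0.
apply: (logconcave_primitive0 z0 (fun t => @is_derive_gamma_cdf2 _ a t a0)
  (fun t => @is_derive_gamma_cdf1 _ a t a0) (fun t => @is_derive_gamma_cdf _ a a0 t)).
- by move=> t; exact: gamma_cdf_gt0.
- by move=> t _; exact: gamma_cdf1_ge0.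
- by move=> t; exact: gamma_cdf1_logconcave.
- exact: gamma_cdf2_cvg0.
Qed.

Lemma gamma_tail1_logconcave a z : 1 <= a -> 0 < z -> Q1 a z * p a z <= Q a z ^+ 2.
Proof.
move=> a1 z0; have a0 : 0 < a by lra.
apply: (logconcave_primitivey z0 (fun t => @is_derive_gamma_tail1 _ a t a0)
  (fun t => @is_derive_gamma_tail _ a t a0) (fun t => @is_derive_gamma_density _ a t)).
- by move=> t; exact: gamma_density_gt0.
- by move=> t; exact: gamma_tail_ge0.
- move=> t t0; rewrite mulrCA -mulrN expr2 ler_pM2l ?gamma_density_gt0//.
  exact: gamma_tail_logderiv.
- exact: gamma_tail1_cvgy.
Qed.

Lemma gamma_tail2_logconcave a z : 1 <= a -> 0 < z -> Q2 a z * Q a z <= Q1 a z ^+ 2.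
Proof.
move=> a1 z0; have a0 : 0 < a by lra.
apply: (logconcave_primitivey z0 (fun t => @is_derive_gamma_tail2 _ a t a0)
  (fun t => @is_derive_gamma_tail1 _ a t a0) (fun t => @is_derive_gamma_tail _ a t a0)).
- by move=> t; exact: gamma_tail_gt0.
- by move=> t; exact: gamma_tail1_ge0.
- by move=> t t0; rewrite mulrN opprK; exact: gamma_tail1_logconcave.
- exact: gamma_tail2_cvgy.
Qed.

(** Write [s = z - a]. Since [z p = P1 - s P], the inequality [P1 p <= P ^ 2] says that [x = P / P1]
    satisfies [1 <= z x ^ 2 + s x]. In the same way [y = Q / Q1] satisfies this with [- s]. Adding
    the two solved inequalities cancels [s], and the Wronskian identity evaluates [C1 * 2 z (x + y)]
    to 4. *)
Lemma C1_sqrt_le a z : 1 <= a -> 0 < z ->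
  C1 a z * Num.sqrt ((z - a) ^+ 2 + 4 * z) <= 2.
Proof.
move=> a1 z0; have a0 : 0 < a by lra.
have p0 := gamma_density_gt0 a0 z0.
have hP := gamma_cdf1_logconcave a0 z0; have hQ := gamma_tail1_logconcave a1 z0.
have eP := gamma_cdf1E a0 z0; have eQ := gamma_tail1E a0 z0.
have W := gamma_wronskian1 a0 z0.
have P0 := gamma_cdf_gt0 a0 z0; have Q0 := gamma_tail_gt0 a0 z0.
have P10 := gamma_cdf1_gt0 a0 z0; have Q10 := gamma_tail1_gt0 a0 z0.
rewrite C1E//.
move: (P a z) (Q a z) (P1 a z) (Q1 a z) (p a z) P0 Q0 P10 Q10 p0 hP hQ eP eQ W.
move=> u v u1 v1 q u0 v0 u10 v10 q0 hu hv eu ev W.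
have Du : Num.sqrt ((z - a) ^+ 2 + 4 * 1 * z) <= 2 * z * (u / u1) + (z - a).
  apply: sqrt_le_quadratic => //; first exact: divr_gt0.
  have -> : z * (u / u1) ^+ 2 + (z - a) * (u / u1) =
      (z * u ^+ 2 + (z - a) * u * u1) / u1 ^+ 2 by field; rewrite gt_eqF.
  by rewrite ler_pdivlMr ?exprn_gt0//; nra.
have Dv : Num.sqrt ((- (z - a)) ^+ 2 + 4 * 1 * z) <= 2 * z * (v / v1) + - (z - a).
  apply: sqrt_le_quadratic => //; first exact: divr_gt0.
  have -> : z * (v / v1) ^+ 2 + - (z - a) * (v / v1) =
      (z * v ^+ 2 - (z - a) * v * v1) / v1 ^+ 2 by field; rewrite gt_eqF.
  by rewrite ler_pdivlMr ?exprn_gt0//; nra.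
rewrite sqrrN in Dv; rewrite mulr1 in Du Dv.
have D0 : 0 < 2 * (u1 * v1) / (z * (z * q)) by rewrite divr_gt0 ?mulr_gt0.
have := ler_wpM2l (ltW D0) (lerD Du Dv).
have -> : 2 * (u1 * v1) / (z * (z * q)) *
    (2 * z * (u / u1) + (z - a) + (2 * z * (v / v1) + - (z - a))) =
    4 * (u * v1 + v * u1) / (z * q).
  by field; rewrite !gt_eqF.
rewrite W mulfK ?gt_eqF ?mulr_gt0//; lra.
Qed.

(** The same argument one integration higher. From [z P = 2 P2 - (s - 1) P1], the ratio [P1 / P2]
    satisfies the quadratic inequality with constant 2 and with [s - 1] in place of [s]. *)
Lemma C2_sqrt_le a z : 1 <= a -> 0 < z ->
  C2 a z * Num.sqrt ((z - a - 1) ^+ 2 + 8 * z) <= 2.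
Proof.
move=> a1 z0; have a0 : 0 < a by lra.
have p0 := gamma_density_gt0 a0 z0.
have hP := gamma_cdf2_logconcave a0 z0; have hQ := gamma_tail2_logconcave a1 z0.
have eP : z * P a z + (z - a - 1) * P1 a z = 2 * P2 a z.
  by rewrite gamma_cdf2E// gamma_cdf1E//; field.
have eQ : z * Q a z - (z - a - 1) * Q1 a z = 2 * Q2 a z.
  by rewrite gamma_tail2E// gamma_tail1E//; field.
have W := gamma_wronskian2 a0 z0.
have P0 := gamma_cdf1_gt0 a0 z0; have Q0 := gamma_tail1_gt0 a0 z0.
have P10 := gamma_cdf2_gt0 a0 z0; have Q10 := gamma_tail2_gt0 a0 z0.
rewrite C2E//.
move: (P a z) (Q a z) (P1 a z) (Q1 a z) (P2 a z) (Q2 a z) (p a z)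
  P0 Q0 P10 Q10 p0 hP hQ eP eQ W.
move=> w x u v u1 v1 q u0 v0 u10 v10 q0 hu hv eu ev W.
have Du : Num.sqrt ((z - a - 1) ^+ 2 + 4 * 2 * z) <= 2 * z * (u / u1) + (z - a - 1).
  apply: sqrt_le_quadratic => //; first exact: divr_gt0.
  have -> : z * (u / u1) ^+ 2 + (z - a - 1) * (u / u1) =
      (z * u ^+ 2 + (z - a - 1) * u * u1) / u1 ^+ 2 by field; rewrite gt_eqF.
  by rewrite ler_pdivlMr ?exprn_gt0//; nra.
have Dv : Num.sqrt ((- (z - a - 1)) ^+ 2 + 4 * 2 * z) <=
    2 * z * (v / v1) + - (z - a - 1).
  apply: sqrt_le_quadratic => //; first exact: divr_gt0.
  have -> : z * (v / v1) ^+ 2 + - (z - a - 1) * (v / v1) =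
      (z * v ^+ 2 - (z - a - 1) * v * v1) / v1 ^+ 2 by field; rewrite gt_eqF.
  by rewrite ler_pdivlMr ?exprn_gt0//; nra.
rewrite sqrrN in Dv; rewrite (_ : 4 * 2 = 8 :> R) in Du Dv; last by ring.
have D0 : 0 < 4 * (u1 * v1) / (z ^+ 2 * (z * q)).
  by rewrite divr_gt0 ?mulr_gt0 ?exprn_gt0.
have := ler_wpM2l (ltW D0) (lerD Du Dv).
have -> : 4 * (u1 * v1) / (z ^+ 2 * (z * q)) *
    (2 * z * (u / u1) + (z - a - 1) + (2 * z * (v / v1) + - (z - a - 1))) =
    8 * (u * v1 + v * u1) / (z * (z * q)).
  by field; rewrite !gt_eqF.
rewrite W; have -> : 8 * (z * (z * q) / 2) / (z * (z * q)) = 4.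
  by field; rewrite !gt_eqF.
lra.
Qed.

End OuterBounds.

(** * Numerical inequalities *)

Section CenterPolynomials.
Variable R : realFieldType.
Implicit Type u : R.

(** Taylor polynomial of degree 5 of [exp (- u / 2)], a lower bound for [u >= 0]. *)
Definition exp_lo u : R :=
  1 - u / 2 + u ^+ 2 / 8 - u ^+ 3 / 48 + u ^+ 4 / 384 - u ^+ 5 / 3840.

(* With [g x = exp (- x^2 / 2)] and [u = t^2], [center_r u] is a Taylor polynomial of
   [1 + \int_0^t \int_0^x g] from above, and [t * center_b u] is one of the integral of
   that function over [0, t] from below. *)
Definition center_r u : R :=
  1 + u / 2 - u ^+ 2 / 24 + u ^+ 3 / 240 - u ^+ 4 / 2688 + u ^+ 5 / (3840 * 9).

Definition center_b u : R :=
  1 + u / 6 - u ^+ 2 / 120 + u ^+ 3 / 1680 - u ^+ 4 / (2688 * 9).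

(* The difference of the two sides has nonnegative Bernstein coefficients on [0, 64/25]. *)
Lemma center_r_ineq u : 0 <= u <= 64 / 25 ->
  center_r u ^+ 2 <= exp_lo u + 157 / 100 * u.
Proof.
move=> /andP[u0 u1].
have bern i j : 0 <= u * (u ^+ i * (64 / 25 - u) ^+ j).
  by rewrite !mulr_ge0// exprn_ge0// subr_ge0.
rewrite /center_r /exp_lo.
have := bern 0 9; have := bern 1 8; have := bern 2 7; have := bern 3 6;
have := bern 4 5; have := bern 5 4; have := bern 6 3; have := bern 7 2;
have := bern 8 1; have := bern 9 0.
lra.
Qed.
(** The same kind of certificate, one degree lower. The constant [7 / 11] is below [2 / pi] because
    [pi < 22 / 7]. *)
Lemma center_b_ineq u : 0 <= u <= 64 / 25 ->
  (1 + u) ^+ 2 / 4 <= exp_lo u / 4 + 7 / 11 * u * center_b u ^+ 2.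
Proof.
move=> /andP[u0 u1].
have bern i j : 0 <= u * (u ^+ i * (64 / 25 - u) ^+ j).
  by rewrite !mulr_ge0// exprn_ge0// subr_ge0.
rewrite /center_b /exp_lo.
have := bern 0 8; have := bern 1 7; have := bern 2 6; have := bern 3 5;
have := bern 4 4; have := bern 5 3; have := bern 6 2; have := bern 7 1;
have := bern 8 0.
lra.
Qed.
End CenterPolynomials.

(** Discharges the premises of [le_of_is_derive_le]: the values at 0, the two derivatives, and the
    inequality between them, which is the previous bound [lem], possibly negated. *)
Ltac taylor lem := first
  [ by rewrite ?oppr0 ?expR0 ?sin0 ?cos0; lra
  | by move=> t _; exact: is_derive_sin
  | by move=> t _; exact: is_derive_cos
  | by move=> t _; derive; field
  | by move=> t /andP[t0 _]; rewrite ?mulN1r ?lerN2; apply: lem ].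

(** * Rational bounds for pi from Taylor bounds of sine and cosine *)

Section PiBounds.
Context {R : realType}.
Implicit Types (f g : R -> R) (t x : R).

Let sin_upper1 x : 0 <= x -> sin x <= x.
Proof.
move=> x0; apply: (@le_of_is_derive_le _ sin (fun t => t) cos (fun=> 1) x x0); taylor cos_le1.
Qed.

Let cos_lower2 x : 0 <= x -> 1 - x ^+ 2 / 2 <= cos x.
Proof.
move=> x0; apply: (@le_of_is_derive_le _ (fun t => 1 - t ^+ 2 / 2) cos
  (fun t => - t) (fun t => - sin t) x x0); taylor sin_upper1.
Qed.

Let sin_lower3 x : 0 <= x -> x - x ^+ 3 / 6 <= sin x.
Proof.
move=> x0; apply: (@le_of_is_derive_le _ (fun t => t - t ^+ 3 / 6) sin
  (fun t => 1 - t ^+ 2 / 2) cos x x0); taylor cos_lower2.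
Qed.

Let cos_upper4 x : 0 <= x -> cos x <= 1 - x ^+ 2 / 2 + x ^+ 4 / 24.
Proof.
move=> x0; apply: (@le_of_is_derive_le _ cos (fun t => 1 - t ^+ 2 / 2 + t ^+ 4 / 24)
  (fun t => - sin t) (fun t => - (t - t ^+ 3 / 6)) x x0); taylor sin_lower3.
Qed.

Let sin_upper5 x : 0 <= x -> sin x <= x - x ^+ 3 / 6 + x ^+ 5 / 120.
Proof.
move=> x0; apply: (@le_of_is_derive_le _ sin (fun t => t - t ^+ 3 / 6 + t ^+ 5 / 120)
  cos (fun t => 1 - t ^+ 2 / 2 + t ^+ 4 / 24) x x0); taylor cos_upper4.
Qed.

Let cos_lower6 x : 0 <= x -> 1 - x ^+ 2 / 2 + x ^+ 4 / 24 - x ^+ 6 / 720 <= cos x.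
Proof.
move=> x0; apply: (@le_of_is_derive_le _
  (fun t => 1 - t ^+ 2 / 2 + t ^+ 4 / 24 - t ^+ 6 / 720) cos
  (fun t => - (t - t ^+ 3 / 6 + t ^+ 5 / 120)) (fun t => - sin t) x x0); taylor sin_upper5.
Qed.

Let sin_lower7 x : 0 <= x ->
  x - x ^+ 3 / 6 + x ^+ 5 / 120 - x ^+ 7 / (720 * 7) <= sin x.
Proof.
move=> x0; apply: (@le_of_is_derive_le _
  (fun t => t - t ^+ 3 / 6 + t ^+ 5 / 120 - t ^+ 7 / (720 * 7)) sin
  (fun t => 1 - t ^+ 2 / 2 + t ^+ 4 / 24 - t ^+ 6 / 720) cos x x0); taylor cos_lower6.
Qed.

Let cos_upper8 x : 0 <= x ->
  cos x <= 1 - x ^+ 2 / 2 + x ^+ 4 / 24 - x ^+ 6 / 720 + x ^+ 8 / (720 * 56).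
Proof.
move=> x0; apply: (@le_of_is_derive_le _ cos
  (fun t => 1 - t ^+ 2 / 2 + t ^+ 4 / 24 - t ^+ 6 / 720 + t ^+ 8 / (720 * 56))
  (fun t => - sin t)
  (fun t => - (t - t ^+ 3 / 6 + t ^+ 5 / 120 - t ^+ 7 / (720 * 7))) x x0); taylor sin_lower7.
Qed.

(** Otherwise [157 / 200] would be at least [pi / 4], where the tangent is 1, so cosine would not
    exceed sine there; the Taylor bounds contradict this. The upper bound for pi is the same
    argument at [11 / 14]. *)
Lemma pi_gt_314 : 157 / 50 < pi :> R.
Proof.
have pi2 := @pi_ge2 R; have [//|pile] := ltP (157 / 50) (pi : R).
have x0 : 0 <= 157 / 200 :> R by lra.
have := sin_upper5 x0; have := cos_lower6 x0.
have : cos (157 / 200 : R) <= sin (157 / 200 : R).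
  have tan1 : 1 <= tan (157 / 200 : R).
    by rewrite -[leLHS]tan_piquarter leNgt ltr_tan ?in_itv/=; rewrite -?leNgt; lra.
  have c0 : 0 < cos (157 / 200 : R) by apply: cos_gt0_pihalf; lra.
  by move: tan1; rewrite /tan ler_pdivlMr// mul1r.
lra.
Qed.

Lemma pi_lt_22_7 : pi < 22 / 7 :> R.
Proof.
have pi2 := @pi_ge2 R; have [//|pile] := ltP (pi : R) (22 / 7).
have x0 : 0 <= 11 / 14 :> R by lra.
have := sin_lower7 x0; have := cos_upper8 x0.
have : sin (11 / 14 : R) <= cos (11 / 14 : R).
  have tan1 : tan (11 / 14 : R) <= 1.
    by rewrite -[leRHS]tan_piquarter leNgt ltr_tan ?in_itv/=; rewrite -?leNgt; lra.
  have c0 : 0 < cos (11 / 14 : R) by apply: cos_gt0_pihalf; lra.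
  by move: tan1; rewrite /tan ler_pdivrMr// mul1r.
lra.
Qed.

End PiBounds.

(** * The central region *)

Section ExpBounds.
Context {R : realType}.
Implicit Types (x v : R).

Let expN_ge1 x : 0 <= x -> 1 - x <= expR (- x).
Proof. by move=> x0; exact: expR_ge1Dx. Qed.

Let expN_le2 x : 0 <= x -> expR (- x) <= 1 - x + x ^+ 2 / 2.
Proof.
move=> x0; apply: (@le_of_is_derive_le _ (fun t => expR (- t))
  (fun t => 1 - t + t ^+ 2 / 2) (fun t => - 1 * expR (- t)) (fun t => - (1 - t)) x x0).
all: taylor expN_ge1.
Qed.

Lemma expRN_ge3 x : 0 <= x -> 1 - x + x ^+ 2 / 2 - x ^+ 3 / 6 <= expR (- x).
Proof.
move=> x0; apply: (@le_of_is_derive_le _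
  (fun t => 1 - t + t ^+ 2 / 2 - t ^+ 3 / 6) (fun t => expR (- t))
  (fun t => - (1 - t + t ^+ 2 / 2)) (fun t => - 1 * expR (- t)) x x0).
all: taylor expN_le2.
Qed.

Lemma expRN_le4 x : 0 <= x ->
  expR (- x) <= 1 - x + x ^+ 2 / 2 - x ^+ 3 / 6 + x ^+ 4 / 24.
Proof.
move=> x0; apply: (@le_of_is_derive_le _ (fun t => expR (- t))
  (fun t => 1 - t + t ^+ 2 / 2 - t ^+ 3 / 6 + t ^+ 4 / 24)
  (fun t => - 1 * expR (- t)) (fun t => - (1 - t + t ^+ 2 / 2 - t ^+ 3 / 6)) x x0).
all: taylor expRN_ge3.
Qed.

Lemma expRN_ge5 x : 0 <= x ->
  1 - x + x ^+ 2 / 2 - x ^+ 3 / 6 + x ^+ 4 / 24 - x ^+ 5 / 120 <= expR (- x).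
Proof.
move=> x0; apply: (@le_of_is_derive_le _
  (fun t => 1 - t + t ^+ 2 / 2 - t ^+ 3 / 6 + t ^+ 4 / 24 - t ^+ 5 / 120)
  (fun t => expR (- t)) (fun t => - (1 - t + t ^+ 2 / 2 - t ^+ 3 / 6 + t ^+ 4 / 24))
  (fun t => - 1 * expR (- t)) x x0).
all: taylor expRN_le4.
Qed.

End ExpBounds.

Section CentralRegion.
Context {R : realType}.
Implicit Types a s t : R.

Local Notation p := gamma_density.

(* [s] is a sign, so that [t >= 0] parametrizes either side of the mode. *)
Definition gamma_point a s t : R := a + s * Num.sqrt a * t.

(** The density of the Gamma variable after centering at [a] and division by [sqrt a]. *)
Definition scaled_density a s t : R := Num.sqrt a * p a (gamma_point a s t).

(** Its limit is [1 / sqrt (2 pi)], which appears below as [2 * I * mode_height a] tending to 1 for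
    [I = sqrt (pi / 2)]. *)
Definition mode_height a : R := Num.sqrt a * p a a.

Local Notation zt := gamma_point.
Local Notation dt := scaled_density.

Lemma gamma_point0 a s : zt a s 0 = a.
Proof. by rewrite /gamma_point mulr0 addr0. Qed.

Lemma scaled_density0 a s : dt a s 0 = mode_height a.
Proof. by rewrite /scaled_density gamma_point0. Qed.

Lemma sqr_sign_cases s : s ^+ 2 = 1 -> s = 1 \/ s = -1.
Proof. by move=> /eqP; rewrite sqrf_eq1 => /orP[] /eqP; [left|right]. Qed.

Lemma gamma_point_gt0 a s t : 0 < a -> s ^+ 2 = 1 -> 0 <= t -> t < Num.sqrt a ->
  0 < zt a s t.
Proof.
move=> a0 s1 t0 tc; rewrite /gamma_point -{1}(sqr_sqrtr (ltW a0)).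
have c0 : 0 < Num.sqrt a by rewrite sqrtr_gt0.
by move: (Num.sqrt a) c0 tc => c c0 tc; have [->|->] := sqr_sign_cases s1; nra.
Qed.

Lemma is_derive_gamma_point a s t : is_derive t 1 (zt a s) (s * Num.sqrt a).
Proof. by rewrite /gamma_point; derive; ring. Qed.

(** The logarithmic derivative is split into the Gaussian part [- t] and a remainder of order
    [1 / sqrt a] for bounded [t]. *)
Lemma is_derive_scaled_density a s t : 0 < a -> s ^+ 2 = 1 ->
  0 <= t -> t < Num.sqrt a ->
  is_derive t 1 (dt a s)
    (dt a s t * (- t + s * (t ^+ 2 - 1) / (Num.sqrt a + s * t))).
Proof.
move=> a0 s1 t0 tc; have z0 := gamma_point_gt0 a0 s1 t0 tc.
have d := is_derive_comp (is_derive_gamma_density a z0) (is_derive_gamma_point a s t).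
have c0 : 0 < Num.sqrt a by rewrite sqrtr_gt0.
have cE : Num.sqrt a ^+ 2 = a by rewrite sqr_sqrtr// ltW.
have z1 : zt a s t = Num.sqrt a * (Num.sqrt a + s * t).
  by rewrite /gamma_point -[X in X + _]cE; ring.
have cst0 : 0 < Num.sqrt a + s * t.
  by move: z0; rewrite z1 pmulr_rgt0.
rewrite {1}/scaled_density; derive.
rewrite mulr0 addr0 /scaled_density z1.
have -> : a - 1 = Num.sqrt a ^+ 2 - 1 by rewrite cE.
move: (p a (Num.sqrt a * (Num.sqrt a + s * t))) => q.
move: (Num.sqrt a) c0 cst0 => c c0 cst0.
have [e|e] := sqr_sign_cases s1; rewrite {}e in cst0 *; field; rewrite !gt_eqF//; lra.
Qed.

End CentralRegion.

(** * Uniform comparison of the rescaled density with a Gaussian *)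

Section CentralDensity.
Context {R : realType}.
Implicit Types a s t u T h e : R.

Local Notation dt := scaled_density.

Lemma scaled_density_gt0 a s t : 0 < a -> s ^+ 2 = 1 -> 0 <= t ->
  t < Num.sqrt a -> 0 < dt a s t.
Proof.
move=> a0 s1 t0 tc; rewrite /scaled_density mulr_gt0 ?sqrtr_gt0//.
exact: gamma_density_gt0 (gamma_point_gt0 a0 s1 t0 tc).
Qed.

Lemma mode_height_gt0 a : 0 < a -> 0 < mode_height a.
Proof. by move=> a0; rewrite mulr_gt0 ?sqrtr_gt0 ?gamma_density_gt0. Qed.

Lemma scaled_density_logderiv a s T h t : 0 < a -> s ^+ 2 = 1 ->
  0 <= t <= T -> T < Num.sqrt a -> T ^+ 2 + 1 <= h * (Num.sqrt a - T) ->
  - h <= s * (t ^+ 2 - 1) / (Num.sqrt a + s * t) <= h.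
Proof.
move=> a0 s1 /andP[t0 tT] Tc hT.
have c0 : 0 < Num.sqrt a by rewrite sqrtr_gt0.
have T0 : 0 <= T by exact: le_trans tT.
have h0 : 0 < h.
  rewrite -(pmulr_lgt0 _ (_ : 0 < Num.sqrt a - T)) ?subr_gt0//.
  by apply: lt_le_trans hT; rewrite ltr_wpDl ?sqr_ge0.
have tT2 : t ^+ 2 <= T ^+ 2 by rewrite ler_sqr ?nnegrE.
have t20 : 0 <= t ^+ 2 by exact: sqr_ge0.
move: (Num.sqrt a) Tc hT c0 => c Tc hT c0.
have cst0 : 0 < c + s * t.
  by have [->|->] := sqr_sign_cases s1; lra.
have hcst : h * (c - T) <= h * (c + s * t).
  by rewrite ler_pM2l//; have [->|->] := sqr_sign_cases s1; lra.
rewrite ler_pdivlMr// ler_pdivrMr// mulNr.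
by have [e|e] := sqr_sign_cases s1; rewrite {}e in hcst *; apply/andP; split; lra.
Qed.

(** As the remainder lies in [[- h, h]], the density times [exp (t ^ 2 / 2 + h t)] is nondecreasing
    and the density times [exp (t ^ 2 / 2 - h t)] is nonincreasing; both are compared with their
    value at 0. *)
Lemma scaled_density_bounds a s T h t : 0 < a -> s ^+ 2 = 1 ->
  0 <= t <= T -> T < Num.sqrt a -> T ^+ 2 + 1 <= h * (Num.sqrt a - T) ->
  mode_height a * expR (- (t ^+ 2 / 2) - h * t) <= dt a s t <=
  mode_height a * expR (- (t ^+ 2 / 2) + h * t).
Proof.
move=> a0 s1 /andP[t0 tT] Tc hT.
have T0 : 0 <= T by exact: le_trans tT.
have df (w u : R) : 0 <= u <= t -> is_derive u 1
    (fun v => dt a s v * expR (v ^+ 2 / 2 + w * v))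
    (dt a s u * expR (u ^+ 2 / 2 + w * u) *
      (s * (u ^+ 2 - 1) / (Num.sqrt a + s * u) + w)).
  move=> /andP[u0 ut].
  have d := is_derive_scaled_density a0 s1 u0 (le_lt_trans (le_trans ut tT) Tc).
  by derive; set X := s * _ / _; field.
have d0 (u : R) : 0 <= u <= t -> 0 <= dt a s u.
  move=> /andP[u0 ut]; apply/ltW/scaled_density_gt0 => //.
  exact: le_lt_trans (le_trans ut tT) Tc.
have ld (u : R) : 0 <= u <= t ->
    - h <= s * (u ^+ 2 - 1) / (Num.sqrt a + s * u) <= h.
  move=> /andP[u0 ut]; apply: (@scaled_density_logderiv a s T h u) => //.
  by rewrite u0 (le_trans ut tT).
have at0 w : dt a s 0 * expR (0 ^+ 2 / 2 + w * 0) = mode_height a.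
  by rewrite expr0n/= mul0r mulr0 addr0 expR0 mulr1 scaled_density0.
apply/andP; split.
- have : dt a s 0 * expR (0 ^+ 2 / 2 + h * 0) <= dt a s t * expR (t ^+ 2 / 2 + h * t).
    apply: (is_derive_le (f := fun v => dt a s v * expR (v ^+ 2 / 2 + h * v))
      (f' := fun u => dt a s u * expR (u ^+ 2 / 2 + h * u) *
      (s * (u ^+ 2 - 1) / (Num.sqrt a + s * u) + h)) t0).
    move=> u /andP[/ltW u0 /ltW ut]; have ut' : 0 <= u <= t by rewrite u0.
    have /andP[l _] := ld _ ut'.
    rewrite mulr_ge0//; last by rewrite -lerBlDr sub0r.
    by rewrite mulr_ge0 ?expR_ge0 ?d0.
  by rewrite at0 -opprD expRN ler_pdivrMr ?expR_gt0.
- have : - (dt a s 0 * expR (0 ^+ 2 / 2 + - h * 0)) <=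
      - (dt a s t * expR (t ^+ 2 / 2 + - h * t)).
    apply: (is_derive_le (f := fun v => - (dt a s v * expR (v ^+ 2 / 2 + - h * v)))
      (f' := fun u => - (dt a s u * expR (u ^+ 2 / 2 + - h * u) *
      (s * (u ^+ 2 - 1) / (Num.sqrt a + s * u) + - h))) t0).
      by move=> u ut; apply: is_derive_N; exact: df.
    move=> u /andP[/ltW u0 /ltW ut]; have ut' : 0 <= u <= t by rewrite u0.
    have /andP[_ l] := ld _ ut'.
    rewrite -mulrN mulr_ge0//; last by rewrite opprB subr_ge0.
    by rewrite mulr_ge0 ?expR_ge0 ?d0.
  rewrite at0 lerN2.
  have -> : - (t ^+ 2 / 2) + h * t = - (t ^+ 2 / 2 + - h * t) by ring.
  by rewrite expRN ler_pdivlMr ?expR_gt0.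
Qed.

Lemma scaled_density_uniform T e : 0 < T -> 0 < e -> e <= 1 ->
  exists2 A, 1 <= A & forall a, A <= a -> [/\ T <= e * Num.sqrt a, T < Num.sqrt a &
    forall s t, s ^+ 2 = 1 -> 0 <= t <= T ->
      mode_height a * (expR (- (t ^+ 2 / 2)) * (1 - e)) <= dt a s t <=
      mode_height a * (expR (- (t ^+ 2 / 2)) * (1 + e))].
Proof.
move=> T0 e0 e1; pose h := e / (2 * T).
have h0 : 0 < h by rewrite divr_gt0// mulr_gt0.
(* A lower bound for [sqrt a]; its summands make the three conditions [T <= e sqrt a], [T < sqrt a]
   and [T ^ 2 + 1 <= h (sqrt a - T)] hold. *)
pose X := 1 + T / e + T + (T ^+ 2 + 1) / h.
have X0 : 0 <= T / e /\ 0 <= (T ^+ 2 + 1) / h.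
  by split; apply: divr_ge0; rewrite ?addr_ge0 ?sqr_ge0 ?ltW.
have X1 : 1 <= X by rewrite /X; case: X0 => *; lra.
exists (X ^+ 2); first by rewrite expr_ge1// (le_trans ler01).
move=> a aX; have a0 : 0 < a.
  by apply: lt_le_trans aX; rewrite exprn_gt0// (lt_le_trans ltr01).
have Xc : X <= Num.sqrt a.
  rewrite -(ger0_norm (le_trans ler01 X1)) -sqrtr_sqr.
  by rewrite ler_wsqrtr.
have Tc : T < Num.sqrt a by apply: lt_le_trans Xc; rewrite /X; case: X0 => *; lra.
split => // [|s t s1 tT].
  rewrite mulrC -ler_pdivrMr//; apply: le_trans Xc.
  by rewrite /X; case: X0 => *; lra.
have hT : T ^+ 2 + 1 <= h * (Num.sqrt a - T).
  rewrite mulrC -ler_pdivrMr// lerBrDr; apply: le_trans Xc.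
  by rewrite /X; case: X0 => *; lra.
have /andP[dlo dhi] := scaled_density_bounds a0 s1 tT Tc hT.
have k0 := mode_height_gt0 a0.
have htT : h * t <= e / 2.
  have /andP[_ tT'] := tT.
  apply: (@le_trans _ _ (h * T)); first by rewrite ler_pM2l.
  by rewrite /h le_eqVlt; apply/orP; left; apply/eqP; field; rewrite gt_eqF.
have ht0 : 0 <= h * t by rewrite mulr_ge0 ?(ltW h0)//; case/andP: tT.
apply/andP; split.
- apply: le_trans dlo; rewrite ler_pM2l// expRD ler_pM2l ?expR_gt0//.
  by apply: le_trans (expR_ge1Dx _); lra.
- apply: (le_trans dhi); rewrite ler_pM2l// expRD ler_pM2l ?expR_gt0//.
  (* Upper bound through the inverse: [exp (h t) <= 1 / (1 - h t) <= 1 + e], where the last step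
     uses [e <= 1]. *)
  have E : 1 - h * t <= expR (- (h * t)) by exact: expR_ge1Dx.
  rewrite -[h * t]opprK expRN invf_ple ?posrE ?expR_gt0//; last by lra.
  apply: le_trans E; rewrite -div1r ler_pdivrMr; last lra.
  nra.
Qed.

End CentralDensity.

(** * The mode *)

Section GaussPrimitive.
Context {R : realType}.
Notation mu := (@lebesgue_measure R).
Import gauss_integral_proof.
Implicit Types t x : R.

(** Starting the integral at [-1] makes 0 an interior point, so that [J] has a two-sided derivative
    there as well. *)
Let J x := \int[mu]_(t in `[-1, x]) gauss_fun t - \int[mu]_(t in `[-1, 0]) gauss_fun t.

Let gauss_integrable (A : set R) : measurable A -> mu.-integrable A (EFin \o gauss_fun).
Proof. by move=> mA; exact: integrableS (@integrableT_gauss R). Qed.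

Let J_integral0 x : 0 <= x -> J x = integral0_gauss x.
Proof.
move=> x0; rewrite /J /integral0_gauss.
rewrite (@Rintegral_itvB _ _ (BLeft (-1)) (BRight x) 0); last 3 first.
- exact: gauss_integrable.
- by rewrite bnd_simp; lra.
- by rewrite bnd_simp.
by apply: Rintegral_itv_obnd_cbnd; exact: gauss_integrable.
Qed.

Let is_derive_J x : 0 <= x -> is_derive x 1 J (gauss_fun x).
Proof.
move=> x0.
have [dG GE] : derivable (fun y : R => \int[mu]_(t in `[-1, y]) gauss_fun t) x 1 /\
    (fun y : R => \int[mu]_(t in `[-1, y]) gauss_fun t)^`()%classic x = gauss_fun x.
  apply: (@continuous_FTC1_closed R gauss_fun (-1) x (x + 1)).
  - by rewrite ltrDl.
  - exact: gauss_integrable.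
  - lra.
  - exact: continuous_gauss_fun.
have d : is_derive x 1 (fun y : R => \int[mu]_(t in `[-1, y]) gauss_fun t) (gauss_fun x).
  by split; [exact: dG|rewrite -GE derive1E].
rewrite -[gauss_fun x]addr0.
exact: (is_derive_D d (is_derive_const (- \int[mu]_(t in `[-1, 0]) gauss_fun t) x)).
Qed.

Let J_cvg : J x @[x --> +oo] --> Num.sqrt (pi / 4).
Proof.
have : Num.sqrt (@integral0_gauss R x ^+ 2) @[x --> +oo] --> Num.sqrt (pi / 4).
  by apply: continuous_cvg; [exact: sqrt_continuous|exact: cvg_integral0_gauss_sqr].
apply: cvg_trans; apply: near_eq_cvg; near=> x.
have x0 : 0 <= x by near: x; exact: nbhs_pinfty_ge (num_real _).
by rewrite J_integral0// sqrtr_sqr ger0_norm// integral0_gauss_ge0.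
Unshelve. all: by end_near. Qed.

(** The substitution [t = sqrt 2 * x] turns the known integral of [exp (- x ^ 2)] into that of
    [exp (- t ^ 2 / 2)]. *)
Lemma gauss_primitive : exists Psi : R -> R, [/\ Psi 0 = 0,
  forall t, 0 <= t -> is_derive t 1 Psi (expR (- (t ^+ 2 / 2))) &
  Psi t @[t --> +oo] --> Num.sqrt (pi / 2)].
Proof.
pose k : R := Num.sqrt 2; have k0 : 0 < k by rewrite sqrtr_gt0.
have k2 : k ^+ 2 = 2 by rewrite sqr_sqrtr.
exists (fun t => k * J (k^-1 * t)); split.
- by rewrite mulr0 /J subrr mulr0.
- move=> t t0; have kt0 : 0 <= k^-1 * t by rewrite mulr_ge0 ?invr_ge0 ?(ltW k0).
  have dl : is_derive t 1 (fun u => k^-1 * u) k^-1 by derive; ring.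
  have d := is_derive_comp (is_derive_J kt0) dl.
  derive; rewrite mulr0 addr0 mulrA divff ?gt_eqF// mul1r /gauss_fun.
  by congr expR; rewrite exprMn exprVn k2; ring.
- have -> : Num.sqrt (pi / 2) = k * Num.sqrt (pi / 4) :> R.
    have -> : pi / 2 = 2 * (pi / 4) :> R by field.
    by rewrite sqrtrM.
  apply: cvgM; first exact: cvg_cst.
  apply: (cvg_comp (fun t => k^-1 * t) J _ J_cvg).
  apply/cvgryPge => M; near=> t.
  have : k * M <= t by near: t; exact: nbhs_pinfty_ge (num_real _).
  by rewrite -(ler_pM2l k0 M) mulrA divff ?gt_eqF// mul1r.
Unshelve. all: by end_near. Qed.

End GaussPrimitive.

(** * Height of the density and distribution function at [a] *)

Section ModeAsymptotics.
Context {R : realType}.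
Implicit Types a s t T e : R.

Local Notation p := gamma_density.
Local Notation P := gamma_cdf.
Local Notation zt := gamma_point.
Local Notation dt := scaled_density.
Local Notation I := (Num.sqrt (pi / 2) : R).

Lemma sqrt_pihalf_bounds : 1 <= I <= 2.
Proof.
have pi3 := @pi_gt_314 R; have pi4 := @pi_lt_22_7 R.
have I2 : I ^+ 2 = pi / 2 by rewrite sqr_sqrtr//; lra.
have I0 : 0 <= I := sqrtr_ge0 _.
by move: I I2 I0 => J J2 J0; apply/andP; split; nra.
Qed.

(** The sign makes its derivative in [t] equal to [scaled_density] on either side of [a]. The mass
    beyond the point, [Q] for [s = 1] and [P] for [s = -1], is [1 / 2] minus this. *)
Definition centered_cdf a s t : R := s * (P a (zt a s t) - 2^-1).

Lemma is_derive_centered_cdf a s t : 0 < a -> s ^+ 2 = 1 -> 0 <= t ->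
  t < Num.sqrt a -> is_derive t 1 (centered_cdf a s) (dt a s t).
Proof.
move=> a0 s1 t0 tc; have z0 := gamma_point_gt0 a0 s1 t0 tc.
have d := is_derive_comp (is_derive_gamma_cdf a0 z0) (is_derive_gamma_point a s t).
rewrite /centered_cdf; derive; rewrite mulr0 !addr0 /scaled_density.
by rewrite !mulrA -expr2 s1 mul1r.
Qed.

(** By the closed forms, [Q1 >= 0] or [P1 >= 0] bounds the mass beyond [z] by [z p / |z - a|]. Since
    [T < sqrt a], also [z <= 2 a], whence the factor 2. *)
Lemma centered_cdf_tail a s T : 0 < a -> s ^+ 2 = 1 -> 0 < T -> T < Num.sqrt a ->
  0 <= 2^-1 - centered_cdf a s T <= 2 * dt a s T / T.
Proof.
move=> a0 s1 T0 Tc; have z0 := gamma_point_gt0 a0 s1 (ltW T0) Tc.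
have c0 : 0 < Num.sqrt a by rewrite sqrtr_gt0.
have cE : a = Num.sqrt a ^+ 2 by rewrite sqr_sqrtr// ltW.
have P0 := gamma_cdf_ge0 a0 z0; have Q0 := gamma_tail_ge0 a0 z0.
have P10 := gamma_cdf1_ge0 (zt a s T) a0; have Q10 := gamma_tail1_ge0 a0 z0.
have p0 := gamma_density_gt0 a0 z0.
rewrite gamma_cdf1E// in P10; rewrite gamma_tail1E// in Q10.
rewrite gamma_tailE// in Q0 Q10.
rewrite ler_pdivlMr// /scaled_density /centered_cdf.
have zE : zt a s T = Num.sqrt a * (Num.sqrt a + s * T).
  by rewrite /gamma_point {1}cE; ring.
have zE' : zt a s T - a = s * Num.sqrt a * T by rewrite /gamma_point; ring.
rewrite zE' zE in P10 Q10 *; rewrite zE in P0 Q0 p0.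
move: (P a (Num.sqrt a * (Num.sqrt a + s * T))) P0 Q0 P10 Q10 => F P0 Q0 P10 Q10.
move: (p a (Num.sqrt a * (Num.sqrt a + s * T))) P10 Q10 p0 => f P10 Q10 p0.
move: (Num.sqrt a) P10 Q10 Tc c0 => c P10 Q10 Tc c0.
have [e|e] := sqr_sign_cases s1; rewrite {}e in P10 Q10 *.
- apply/andP; split; first lra.
  rewrite -(ler_pM2l c0).
  have : c * (c * f) + T * (c * f) <= 2 * (c * (c * f)).
    have : T * (c * f) <= c * (c * f) by rewrite ler_pM2r ?mulr_gt0 ?ltW.
    lra.
  lra.
- apply/andP; split; first lra.
  rewrite -(ler_pM2l c0).
  have : 0 <= T * (c * f) by rewrite !mulr_ge0 ?ltW.
  have : 0 <= c * (c * f) by rewrite !mulr_ge0 ?ltW.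
  lra.
Qed.

(** The mass on each side of [a] is close to [mode_height a * I]: the density is compared with the
    Gaussian up to a large [T], and the rest is a small tail. The sum of the two masses is 1, which
    fixes the height; their difference fixes [P a a]. *)
Lemma mode_asymptotics e : 0 < e -> e <= 1 -> exists2 A, 1 <= A & forall a, A <= a ->
  [/\ 1 - e <= 2 * I * mode_height a <= 1 + e & `|P a a - 2^-1| <= e].
Proof.
move=> e0 e1; pose d := e / 8; have d0 : 0 < d by rewrite divr_gt0.
have [Psi [Psi0 dPsi Psiy]] := @gauss_primitive R.
have Psi_le T : 0 <= T -> Psi T <= I.
  move=> T0; apply: (cvgr_to_ge Psiy); near=> t.
  have Tt : T <= t by near: t; exact: nbhs_pinfty_ge (num_real _).
  apply: (is_derive_le (f' := fun t => expR (- (t ^+ 2 / 2))) Tt).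
    by move=> u /andP[Tu _]; apply: dPsi; exact: le_trans Tu.
  by move=> u _; exact: expR_ge0.
(* [T] is chosen before [a]: the tail beyond it and the missing part of the Gauss integral both cost
   at most [d]. *)
have [T [T0 dT PsiT]] : exists T, [/\ 0 < T, 4 / T <= d & I - d <= Psi T].
  have Psi_ge : \forall t \near +oo, I - d <= Psi t.
    by apply: (cvgr_ge I Psiy); lra.
  near (pinfty_nbhs R) => T; exists T.
  have T4 : 4 / d <= T by near: T; exact: nbhs_pinfty_ge (num_real _).
  have T0 : 0 < T by apply: lt_le_trans T4; rewrite divr_gt0.
  split => //; last by near: T.
  by rewrite ler_pdivrMr// mulrC -ler_pdivrMr.
have d1 : d <= 1 by rewrite /d; lra.
have [A A1 HA] := @scaled_density_uniform R T d T0 d0 d1.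
exists A => // a aA; have a0 : 0 < a by lra.
have [_ Tc unif] := HA _ aA.
have k0 := mode_height_gt0 a0.
(* The middle term is the mass on the side [s] of [a]: [Q a a] for [s = 1] and [P a a] for
   [s = -1]. *)
have W s : s ^+ 2 = 1 -> mode_height a * ((1 - d) * (I - d)) <=
    2^-1 - s * (P a a - 2^-1) <= mode_height a * ((1 + d) * I + d).
  move=> s1.
  have dE t : 0 <= t <= T -> is_derive t 1 (centered_cdf a s) (dt a s t).
    by move=> /andP[t0 tT]; apply: is_derive_centered_cdf => //; exact: le_lt_trans Tc.
  have dPsiM (w t : R) : 0 <= t <= T ->
      is_derive t 1 (fun t => w * Psi t + centered_cdf a s 0)
        (w * expR (- (t ^+ 2 / 2))).
    by move=> /andP[t0 tT]; have dP := dPsi _ t0; derive; ring.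
  have E0 : centered_cdf a s 0 = s * (P a a - 2^-1).
    by rewrite /centered_cdf gamma_point0.
  have /andP[tl0 tl1] := centered_cdf_tail a0 s1 T0 Tc.
  have hi : centered_cdf a s T <=
      mode_height a * (1 + d) * Psi T + centered_cdf a s 0.
    apply: (@le_of_is_derive_le _ (centered_cdf a s)
      (fun t => mode_height a * (1 + d) * Psi t + centered_cdf a s 0) (dt a s)
      (fun t => mode_height a * (1 + d) * expR (- (t ^+ 2 / 2))) T (ltW T0)).
    - by rewrite Psi0 mulr0 add0r.
    - by move=> t tT; have /andP[_] := unif s t s1 tT; rewrite -mulrA [(1 + d) * _]mulrC.
  have lo : mode_height a * (1 - d) * Psi T + centered_cdf a s 0 <=
      centered_cdf a s T.
    apply: (@le_of_is_derive_le _
      (fun t => mode_height a * (1 - d) * Psi t + centered_cdf a s 0)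
      (centered_cdf a s) (fun t => mode_height a * (1 - d) * expR (- (t ^+ 2 / 2)))
      (dt a s) T (ltW T0)).
    - by rewrite Psi0 mulr0 add0r.
    - by move=> t tT; have /andP[+ _] := unif s t s1 tT; rewrite -mulrA [(1 - d) * _]mulrC.
  rewrite E0 in hi lo.
  have TT : 0 <= T <= T by rewrite lexx ltW.
  have /andP[_ dT1] := unif s T s1 TT.
  have dT2 : 2 * dt a s T / T <= mode_height a * d.
    apply: (@le_trans _ _ (mode_height a * (4 / T))); last by rewrite ler_pM2l.
    rewrite [leRHS]mulrA ler_pM2r ?invr_gt0//.
    have eT : expR (- (T ^+ 2 / 2)) <= 1.
      by rewrite -expR0 ler_expR oppr_le0 divr_ge0 ?sqr_ge0.
    have := expR_ge0 (- (T ^+ 2 / 2) : R); move: (expR _) eT dT1 => y y1 dT1 y0.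
    have yd : y * (1 + d) <= 2 by nra.
    have := ler_wpM2l (ltW k0) yd; lra.
  have PsiI := Psi_le _ (ltW T0).
  have l1 : mode_height a * ((1 - d) * (I - d)) <= mode_height a * (1 - d) * Psi T.
    by rewrite -mulrA ler_pM2l//; apply: ler_wpM2l => //; lra.
  have l2 : mode_height a * (1 + d) * Psi T <= mode_height a * ((1 + d) * I).
    by rewrite -mulrA ler_pM2l//; apply: ler_wpM2l => //; lra.
  apply/andP; split; first lra.
  lra.
have /andP[w1 w2] := W 1 (expr1n _ _).
have N1 : (-1) ^+ 2 = 1 :> R by rewrite sqrrN expr1n.
have /andP[w3 w4] := W _ N1.
have /andP[I1 I2] := sqrt_pihalf_bounds.
have d8 : e = 8 * d by rewrite /d; field.
have d18 : d <= 1 / 8 by rewrite /d; lra.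
rewrite d8; move: (I) (mode_height a) (P a a - 2^-1) k0 I1 I2 w1 w2 w3 w4.
move=> J k x k0 J1 J2 w1 w2 w3 w4.
have m0 : 0 < k * J by rewrite mulr_gt0//; lra.
have kJ : k <= k * J by rewrite ler_peMr// ltW.
have kdJ : k * d <= k * J * d by rewrite ler_pM2r.
have kd2 : 0 <= k * d ^+ 2 by rewrite mulr_ge0 ?sqr_ge0 ?ltW.
have lo : k * J * (1 - 2 * d) <= k * ((1 - d) * (J - d)) by lra.
have hi : k * ((1 + d) * J + d) <= k * J * (1 + 2 * d) by lra.
have m1 : 2 * (k * J) <= 1 + 8 * d by nra.
split; last by rewrite ler_norml; nra.
by rewrite -mulrA [J * k]mulrC; apply/andP; split=> //; nra.
Unshelve. all: by end_near. Qed.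

End ModeAsymptotics.

(** * Iterated integrals near [a] against Taylor polynomials *)

Section CentralBounds.
Context {R : realType}.
Implicit Types a s t T e : R.

Local Notation p := gamma_density.
Local Notation P := gamma_cdf.
Local Notation P1 := gamma_cdf1.
Local Notation Q1 := gamma_tail1.
Local Notation P2 := gamma_cdf2.
Local Notation Q2 := gamma_tail2.
Local Notation zt := gamma_point.
Local Notation dt := scaled_density.

(** Normalized so that the derivatives in [t] form a chain: [central_diff] to [2 * central_sum],
    then [central_sum] to [centered_cdf] to [scaled_density]. The estimates below integrate upwards
    along it. *)
Definition central_sum a s t : R :=
  (P1 a (zt a s t) + Q1 a (zt a s t)) / (2 * Num.sqrt a).

Definition central_diff a s t : R := s * (P2 a (zt a s t) - Q2 a (zt a s t)) / a.

Lemma is_derive_central_sum a s t : 0 < a -> s ^+ 2 = 1 -> 0 <= t ->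
  t < Num.sqrt a -> is_derive t 1 (central_sum a s) (centered_cdf a s t).
Proof.
move=> a0 s1 t0 tc; have z0 := gamma_point_gt0 a0 s1 t0 tc.
have c0 : 0 < Num.sqrt a by rewrite sqrtr_gt0.
have d1 := is_derive_comp (is_derive_gamma_cdf1 a0 z0) (is_derive_gamma_point a s t).
have d2 := is_derive_comp (is_derive_gamma_tail1 a0 z0) (is_derive_gamma_point a s t).
rewrite /central_sum /centered_cdf.
derive.
by rewrite gamma_tailE//; field; rewrite gt_eqF.
Qed.

Lemma is_derive_central_diff a s t : 0 < a -> s ^+ 2 = 1 -> 0 <= t ->
  t < Num.sqrt a -> is_derive t 1 (central_diff a s) (2 * central_sum a s t).
Proof.
move=> a0 s1 t0 tc; have z0 := gamma_point_gt0 a0 s1 t0 tc.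
have c0 : 0 < Num.sqrt a by rewrite sqrtr_gt0.
have cE : a = Num.sqrt a ^+ 2 by rewrite sqr_sqrtr// ltW.
have d1 := is_derive_comp (is_derive_gamma_cdf2 a0 z0) (is_derive_gamma_point a s t).
have d2 := is_derive_comp (is_derive_gamma_tail2 a0 z0) (is_derive_gamma_point a s t).
rewrite /central_diff /central_sum.
derive.
move: (P1 a (zt a s t)) (Q1 a (zt a s t)) => u v.
rewrite [in a^-1]cE; move: (Num.sqrt a) c0 => c c0.
transitivity (s ^+ 2 * (u + v) / c); first by field; rewrite gt_eqF.
by rewrite s1; field; rewrite gt_eqF.
Qed.

Lemma central_sum0 a s : 0 < a -> central_sum a s 0 = mode_height a.
Proof.
move=> a0; have c0 : 0 < Num.sqrt a by rewrite sqrtr_gt0.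
have cE : a = Num.sqrt a ^+ 2 by rewrite sqr_sqrtr// ltW.
rewrite /central_sum gamma_point0 gamma_cdf1E// gamma_tail1E// subrr !mul0r.
rewrite /mode_height; move: (p a a) => f.
have -> : a * f = Num.sqrt a ^+ 2 * f by rewrite -cE.
by move: (Num.sqrt a) c0 => c c0; field; rewrite gt_eqF.
Qed.

(** Both terms tend to 0, by the limit of [P a a] and the boundedness of the height. *)
Lemma central_diff0 a s : 0 < a -> central_diff a s 0 =
  s * (P a a - 2^-1) - s * (mode_height a / Num.sqrt a).
Proof.
move=> a0; have c0 : 0 < Num.sqrt a by rewrite sqrtr_gt0.
rewrite /central_diff gamma_point0 gamma_cdf2E// gamma_tail2E// gamma_tailE//.
rewrite /mode_height; move: (p a a) (P a a) (Num.sqrt a) c0 => f F c c0.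
by field; rewrite !gt_eqF.
Qed.

Lemma central_sum_ge0 a s t : 0 < a -> s ^+ 2 = 1 -> 0 <= t ->
  t < Num.sqrt a -> 0 <= central_sum a s t.
Proof.
move=> a0 s1 t0 tc; have z0 := gamma_point_gt0 a0 s1 t0 tc.
apply: divr_ge0; last by rewrite mulr_ge0 ?sqrtr_ge0.
by apply: addr_ge0; [exact: gamma_cdf1_ge0|exact: gamma_tail1_ge0].
Qed.

Section Comparison.
Variables a s T e : R.
Hypotheses (a0 : 0 < a) (s1 : s ^+ 2 = 1) (Tc : T < Num.sqrt a).
Hypothesis (e01 : 0 <= e <= 1).
Hypothesis unif : forall t, 0 <= t <= T ->
  mode_height a * (expR (- (t ^+ 2 / 2)) * (1 - e)) <= dt a s t <=
  mode_height a * (expR (- (t ^+ 2 / 2)) * (1 + e)).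

Let k := mode_height a.
Let e0 := s * (P a a - 2^-1).
Let k0 : 0 < k. Proof. exact: mode_height_gt0. Qed.

Let dE t : 0 <= t <= T -> is_derive t 1 (centered_cdf a s) (dt a s t).
Proof.
by move=> /andP[t0 tT]; apply: is_derive_centered_cdf => //; exact: le_lt_trans Tc.
Qed.

Let dr t : 0 <= t <= T -> is_derive t 1 (central_sum a s) (centered_cdf a s t).
Proof.
by move=> /andP[t0 tT]; apply: is_derive_central_sum => //; exact: le_lt_trans Tc.
Qed.

Let dB t : 0 <= t <= T -> is_derive t 1 (central_diff a s) (2 * central_sum a s t).
Proof.
by move=> /andP[t0 tT]; apply: is_derive_central_diff => //; exact: le_lt_trans Tc.
Qed.

Let E0 : centered_cdf a s 0 = e0.
Proof. by rewrite /centered_cdf gamma_point0. Qed.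

Let half_sq_ge0 (u : R) : 0 <= u ^+ 2 / 2.
Proof. by rewrite divr_ge0 ?sqr_ge0. Qed.

(** First integration: [exp (- u ^ 2 / 2)] is replaced by its Taylor polynomial of degree 4 in
    [u ^ 2 / 2], an upper bound, and integrated termwise. The lower bound after it uses degree 3. *)
Let centered_cdf_le t : 0 <= t <= T -> centered_cdf a s t <=
  e0 + k * (1 + e) * (t - t ^+ 3 / 6 + t ^+ 5 / 40 - t ^+ 7 / 336 + t ^+ 9 / 3456).
Proof.
move=> /andP[t0 tT]; have /andP[e_ge0 _] := e01.
have sub u : 0 <= u <= t -> 0 <= u <= T.
  by move=> /andP[-> ut]; exact: le_trans ut tT.
have dg u : 0 <= u <= t -> is_derive u 1 (fun t =>
    e0 + k * (1 + e) * (t - t ^+ 3 / 6 + t ^+ 5 / 40 - t ^+ 7 / 336 + t ^+ 9 / 3456))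
    (k * (1 + e) * (1 - u ^+ 2 / 2 + u ^+ 4 / 8 - u ^+ 6 / 48 + u ^+ 8 / 384)).
  by move=> _; derive; field.
refine (le_of_is_derive_le t0 _ (fun u ut => dE (sub u ut)) dg _).
  by rewrite E0; lra.
move=> u ut; have /andP[_] := unif (sub u ut).
move=> h; apply: (le_trans h); rewrite -/k -mulrA ler_pM2l// mulrC.
apply: ler_wpM2l; first lra.
by apply: le_trans (expRN_le4 (half_sq_ge0 u)) _; lra.
Qed.

Let centered_cdf_ge t : 0 <= t <= T ->
  e0 + k * (1 - e) * (t - t ^+ 3 / 6 + t ^+ 5 / 40 - t ^+ 7 / 336) <=
  centered_cdf a s t.
Proof.
move=> /andP[t0 tT]; have /andP[_ e_le1] := e01.
have sub u : 0 <= u <= t -> 0 <= u <= T.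
  by move=> /andP[-> ut]; exact: le_trans ut tT.
have dg u : 0 <= u <= t -> is_derive u 1 (fun t =>
    e0 + k * (1 - e) * (t - t ^+ 3 / 6 + t ^+ 5 / 40 - t ^+ 7 / 336))
    (k * (1 - e) * (1 - u ^+ 2 / 2 + u ^+ 4 / 8 - u ^+ 6 / 48)).
  by move=> _; derive; field.
refine (le_of_is_derive_le t0 _ dg (fun u ut => dE (sub u ut)) _).
  by rewrite E0; lra.
move=> u ut; have /andP[h _] := unif (sub u ut).
apply: le_trans h; rewrite -/k -mulrA ler_pM2l// [leRHS]mulrC.
apply: ler_wpM2l; first lra.
by apply: le_trans (expRN_ge3 (half_sq_ge0 u)); lra.
Qed.

(** Second integration, starting from the value [k] at 0. Only the part above 1 of [center_r] comes
    from the density and carries the factor [1 + e]. *)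
Lemma central_sum_le t : 0 <= t <= T ->
  central_sum a s t <= k + e0 * t + k * (1 + e) * (center_r (t ^+ 2) - 1).
Proof.
move=> /andP[t0 tT].
have sub u : 0 <= u <= t -> 0 <= u <= T.
  by move=> /andP[-> ut]; exact: le_trans ut tT.
have dg u : 0 <= u <= t -> is_derive u 1 (fun t =>
    k + e0 * t + k * (1 + e) * (t ^+ 2 / 2 - t ^+ 4 / 24 + t ^+ 6 / 240 -
      t ^+ 8 / 2688 + t ^+ 10 / (3840 * 9)))
    (e0 + k * (1 + e) * (u - u ^+ 3 / 6 + u ^+ 5 / 40 - u ^+ 7 / 336 + u ^+ 9 / 3456)).
  by move=> _; derive; field.
have := le_of_is_derive_le t0 _ (fun u ut => dr (sub u ut)) dg
  (fun u ut => centered_cdf_le (sub u ut)).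
rewrite central_sum0// -/k => h; apply: (le_trans (h _)); last first.
  by rewrite le_eqVlt; apply/orP; left; apply/eqP; rewrite /center_r; field.
by rewrite le_eqVlt; apply/orP; left; apply/eqP; field.
Qed.

Let central_sum_ge t : 0 <= t <= T ->
  k + e0 * t + k * (1 - e) *
    (t ^+ 2 / 2 - t ^+ 4 / 24 + t ^+ 6 / 240 - t ^+ 8 / 2688) <= central_sum a s t.
Proof.
move=> /andP[t0 tT].
have sub u : 0 <= u <= t -> 0 <= u <= T.
  by move=> /andP[-> ut]; exact: le_trans ut tT.
have dg u : 0 <= u <= t -> is_derive u 1 (fun t =>
    k + e0 * t + k * (1 - e) * (t ^+ 2 / 2 - t ^+ 4 / 24 + t ^+ 6 / 240 -
      t ^+ 8 / 2688))
    (e0 + k * (1 - e) * (u - u ^+ 3 / 6 + u ^+ 5 / 40 - u ^+ 7 / 336)).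
  by move=> _; derive; field.
have := le_of_is_derive_le t0 _ dg (fun u ut => dr (sub u ut))
  (fun u ut => centered_cdf_ge (sub u ut)).
rewrite central_sum0// -/k => h; apply: h.
by rewrite le_eqVlt; apply/orP; left; apply/eqP; field.
Qed.

(** Third integration, of the lower bounds; it produces [t * center_b (t ^ 2)] up to errors in [e]
    and [e0]. *)
Lemma central_diff_ge t : 0 <= t <= T ->
  central_diff a s 0 + e0 * t ^+ 2 + 2 * k * t +
    2 * k * (1 - e) * t * (center_b (t ^+ 2) - 1) <= central_diff a s t.
Proof.
move=> /andP[t0 tT].
have sub u : 0 <= u <= t -> 0 <= u <= T.
  by move=> /andP[-> ut]; exact: le_trans ut tT.
have dg u : 0 <= u <= t -> is_derive u 1 (fun t =>
    central_diff a s 0 + 2 * k * t + e0 * t ^+ 2 + 2 * (k * (1 - e)) *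
     (t ^+ 3 / 6 - t ^+ 5 / 120 + t ^+ 7 / 1680 - t ^+ 9 / (2688 * 9)))
    (2 * (k + e0 * u + k * (1 - e) * (u ^+ 2 / 2 - u ^+ 4 / 24 + u ^+ 6 / 240 -
      u ^+ 8 / 2688))).
  by move=> _; derive; field.
have step (u : R) : 0 <= u <= t -> 2 * (k + e0 * u + k * (1 - e) *
      (u ^+ 2 / 2 - u ^+ 4 / 24 + u ^+ 6 / 240 - u ^+ 8 / 2688)) <=
    2 * central_sum a s u.
  by move=> ut; rewrite ler_pM2l//; apply: central_sum_ge; exact: sub.
have := le_of_is_derive_le t0 _ dg (fun u ut => dB (sub u ut)) step.
move=> h; apply: le_trans (h _).
  by rewrite le_eqVlt; apply/orP; left; apply/eqP; rewrite /center_b; field.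
by rewrite le_eqVlt; apply/orP; left; apply/eqP; field.
Qed.

End Comparison.

End CentralBounds.

(** * Coefficients near [a] and estimates of their numerators *)

Section CentralCoefficients.
Context {R : realType}.
Implicit Types a s t e : R.

Local Notation p := gamma_density.
Local Notation P1 := gamma_cdf1.
Local Notation Q1 := gamma_tail1.
Local Notation P2 := gamma_cdf2.
Local Notation Q2 := gamma_tail2.
Local Notation zt := gamma_point.
Local Notation dt := scaled_density.
Local Notation I := (Num.sqrt (pi / 2) : R).

(** Uses [4 P1 Q1 = (P1 + Q1) ^ 2 - (P1 - Q1) ^ 2], where [P1 - Q1 = z - a] is explicit. *)
Lemma C1_central a s t : 0 < a -> s ^+ 2 = 1 -> 0 <= t -> t < Num.sqrt a ->
  Num.sqrt a * C1 a (zt a s t) =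
  2 * (central_sum a s t ^+ 2 - t ^+ 2 / 4) /
    ((1 + s * t / Num.sqrt a) ^+ 2 * dt a s t).
Proof.
move=> a0 s1 t0 tc; have z0 := gamma_point_gt0 a0 s1 t0 tc.
have c0 : 0 < Num.sqrt a by rewrite sqrtr_gt0.
have cE : a = Num.sqrt a ^+ 2 by rewrite sqr_sqrtr// ltW.
have p0 := gamma_density_gt0 a0 z0.
have zE : zt a s t = Num.sqrt a * (Num.sqrt a + s * t).
  by rewrite /gamma_point {1}cE; ring.
have uv : P1 a (zt a s t) - Q1 a (zt a s t) = s * Num.sqrt a * t.
  by rewrite gamma_cdf1E// gamma_tail1E// gamma_tailE// /gamma_point; ring.
rewrite C1E// /central_sum /scaled_density.
move: (p a (zt a s t)) (P1 a (zt a s t)) (Q1 a (zt a s t)) p0 uv => f u v p0 uv.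
rewrite zE in z0 *; move: (Num.sqrt a) c0 tc uv z0 => c c0 tc uv z0.
have cs0 : 0 < c + s * t by rewrite pmulr_rgt0 in z0.
have -> : u = v + s * c * t by rewrite -uv; ring.
have -> : t ^+ 2 / 4 = s ^+ 2 * t ^+ 2 / 4 by rewrite s1 mul1r.
by field; rewrite !gt_eqF.
Qed.

(** Here the explicit quantity is the sum, [P2 + Q2 = a (1 + t ^ 2) / 2], so the unknown difference
    enters with a minus sign and must be bounded from below. *)
Lemma C2_central a s t : 0 < a -> s ^+ 2 = 1 -> 0 <= t -> t < Num.sqrt a ->
  Num.sqrt a * C2 a (zt a s t) =
  ((1 + t ^+ 2) ^+ 2 / 4 - central_diff a s t ^+ 2) /
    ((1 + s * t / Num.sqrt a) ^+ 3 * dt a s t).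
Proof.
move=> a0 s1 t0 tc; have z0 := gamma_point_gt0 a0 s1 t0 tc.
have c0 : 0 < Num.sqrt a by rewrite sqrtr_gt0.
have cE : a = Num.sqrt a ^+ 2 by rewrite sqr_sqrtr// ltW.
have p0 := gamma_density_gt0 a0 z0.
have zE : zt a s t = Num.sqrt a * (Num.sqrt a + s * t).
  by rewrite /gamma_point {1}cE; ring.
have uv : P2 a (zt a s t) + Q2 a (zt a s t) = Num.sqrt a ^+ 2 * (1 + t ^+ 2) / 2.
  rewrite gamma_cdf2E// gamma_tail2E// gamma_tailE//.
  transitivity (((zt a s t - a) ^+ 2 + a) / 2); first by field.
  have -> : zt a s t - a = s * Num.sqrt a * t by rewrite /gamma_point; ring.
  rewrite [X in _ + X]cE; transitivity ((s ^+ 2 * Num.sqrt a ^+ 2 * t ^+ 2 + Num.sqrt a ^+ 2) / 2).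
    by ring.
  by rewrite s1; ring.
have -> : central_diff a s t ^+ 2 =
    (P2 a (zt a s t) - Q2 a (zt a s t)) ^+ 2 / (Num.sqrt a ^+ 2) ^+ 2.
  by rewrite /central_diff expr_div_n exprMn s1 mul1r [in a ^+ 2]cE.
rewrite C2E// /scaled_density.
move: (p a (zt a s t)) (P2 a (zt a s t)) (Q2 a (zt a s t)) p0 uv => f u v p0 uv.
rewrite zE in z0 *; move: (Num.sqrt a) c0 tc uv z0 => c c0 tc uv z0.
have cs0 : 0 < c + s * t by rewrite pmulr_rgt0 in z0.
have -> : (1 + t ^+ 2) ^+ 2 = ((u + v) * 2 / c ^+ 2) ^+ 2.
  by congr (_ ^+ 2); rewrite uv; field; rewrite gt_eqF.
by field; rewrite !gt_eqF.
Qed.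

(** The Gaussian factor [g] cancels. At most three factors [1 - e] come from [w] and two from [D],
    hence the fifth power. *)
Lemma ratio_le (N D w g K e : R) n : 0 <= e -> e < 1 -> 0 <= K -> 0 < g ->
  N <= g * (1 + K * e) -> g * (1 - e) ^+ 2 <= D -> 1 - e <= w ->
  (n <= 3)%N -> N / (w ^+ n * D) <= (1 + K * e) / (1 - e) ^+ 5.
Proof.
move=> e0 e1 K0 g0 NK De we n3.
have f0 : 0 < 1 - e by rewrite subr_gt0.
have w0 : 0 < w by exact: lt_le_trans we.
have D0 : 0 < D by apply: lt_le_trans De; rewrite mulr_gt0 ?exprn_gt0.
have Ke0 : 0 <= 1 + K * e by rewrite addr_ge0 ?mulr_ge0.
rewrite ler_pdivrMr ?mulr_gt0 ?exprn_gt0//.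
apply: (le_trans NK); rewrite mulrC -mulrA ler_wpM2l//.
rewrite ler_pdivlMl ?exprn_gt0//.
apply: le_trans (ler_pM _ _ (_ : (1 - e) ^+ 3 <= w ^+ n) De); last first.
- apply: (@le_trans _ _ ((1 - e) ^+ n)).
    by apply: ler_wiXn2l => //; lra.
  by apply: lerXn2r; rewrite ?nnegrE ?(ltW f0) ?(ltW w0).
- by rewrite mulr_ge0 ?sqr_ge0 ?ltW.
- by rewrite exprn_ge0 ?ltW.
by rewrite le_eqVlt; apply/orP; left; apply/eqP; ring.
Qed.

Lemma center_r_ge1 (u : R) : 0 <= u <= 64 / 25 -> 1 <= center_r u.
Proof.
move=> /andP[u0 u1]; rewrite /center_r.
have h1 : 0 <= u * (64 / 25 - u) by rewrite mulr_ge0// subr_ge0.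
have h3 : 0 <= u ^+ 3 * (64 / 25 - u) by rewrite mulr_ge0 ?exprn_ge0// subr_ge0.
have h5 : 0 <= u ^+ 5 by rewrite exprn_ge0.
have h2 : 0 <= u ^+ 3 by rewrite exprn_ge0.
lra.
Qed.

Lemma center_b_bounds (u : R) : 0 <= u <= 64 / 25 -> 1 <= center_b u <= 3 / 2.
Proof.
move=> /andP[u0 u1]; rewrite /center_b.
have h1 : 0 <= u * (64 / 25 - u) by rewrite mulr_ge0// subr_ge0.
have h3 : 0 <= u ^+ 3 * (64 / 25 - u) by rewrite mulr_ge0 ?exprn_ge0// subr_ge0.
have h4 : 0 <= u ^+ 2 * (64 / 25 - u) by rewrite mulr_ge0 ?exprn_ge0// subr_ge0.
have h5 : 0 <= u ^+ 2 by rewrite exprn_ge0.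
have h2 : 0 <= u ^+ 3 by rewrite exprn_ge0.
have h6 : 0 <= u ^+ 4 by rewrite exprn_ge0.
by apply/andP; split; lra.
Qed.

(** Multiplication by [2 * I] normalizes [k] to nearly 1 and turns [t ^ 2 / 4] into
    [pi / 2 * t ^ 2], so [center_r_ineq] applies through [157 / 100 < pi / 2]. The error is
    [720 = 6 * 120]: [center_r ^ 2 <= 6], and [(1 + 10 e) ^ 2 <= 1 + 120 e]. *)
Lemma numerator_r_le (r k e0 e t g : R) : 0 <= t <= 8 / 5 -> 0 <= e <= 1 ->
  2 * I * k <= 1 + e -> 0 <= k -> `|e0| <= e -> 0 <= r ->
  r <= k + e0 * t + k * (1 + e) * (center_r (t ^+ 2) - 1) ->
  exp_lo (t ^+ 2) <= g <= 1 ->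
  (2 * I) ^+ 2 * (r ^+ 2 - t ^+ 2 / 4) <= g + 720 * e.
Proof.
move=> /andP[t0 t1] /andP[e0_ e1] mle k0 e0le r0 rle /andP[gl g1].
have pi3 := @pi_gt_314 R.
have I2 : I ^+ 2 = pi / 2 by rewrite sqr_sqrtr// divr_ge0// pi_ge0.
have /andP[I_ge1 I_le2] := @sqrt_pihalf_bounds R.
have tT : t ^+ 2 <= 64 / 25.
  have -> : 64 / 25 = (8 / 5) ^+ 2 :> R by field.
  by rewrite ler_sqr ?nnegrE//; lra.
have u0 : 0 <= t ^+ 2 by exact: sqr_ge0.
have uT : 0 <= t ^+ 2 <= 64 / 25 by rewrite u0.
have R1 := center_r_ge1 uT; have ineq := center_r_ineq uT.
have m0 : 0 <= 2 * I * k by rewrite !mulr_ge0//; lra.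
have Je : 2 * I * (e0 * t) <= 32 / 5 * e.
  have e0t : e0 * t <= e * (8 / 5).
    apply: (@le_trans _ _ (`|e0| * t)); last exact: ler_pM.
    by rewrite ler_wpM2r// ler_norm.
  apply: (@le_trans _ _ (2 * I * (e * (8 / 5)))); first by rewrite ler_pM2l//; lra.
  have : I * e <= 2 * e by rewrite ler_wpM2r.
  lra.
have rho : 2 * I * r <= center_r (t ^+ 2) * (1 + 10 * e).
  have h : 2 * I * r <= 2 * I * (k + e0 * t + k * (1 + e) * (center_r (t ^+ 2) - 1)).
    by rewrite ler_pM2l//; lra.
  apply: (le_trans h).
  move: (center_r _) R1 => C C1.
  have h2 : 2 * I * k * ((1 + e) * (C - 1)) <= (1 + e) * ((1 + e) * (C - 1)).
    by apply: ler_wpM2r => //; rewrite mulr_ge0//; lra.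
  have h3 : e ^+ 2 <= e by rewrite expr2 ler_piMl.
  have h4 : e ^+ 2 * (C - 1) <= e * (C - 1) by rewrite ler_wpM2r// subr_ge0.
  have h5 : 0 <= e * (C - 1) by rewrite mulr_ge0// subr_ge0.
  lra.
have rho0 : 0 <= 2 * I * r by rewrite !mulr_ge0//; lra.
have rho2 : (2 * I * r) ^+ 2 <= (center_r (t ^+ 2) * (1 + 10 * e)) ^+ 2.
  by rewrite ler_sqr ?nnegrE// (le_trans rho0).
have -> : (2 * I) ^+ 2 * (r ^+ 2 - t ^+ 2 / 4) =
    (2 * I * r) ^+ 2 - I ^+ 2 * t ^+ 2 by field.
rewrite I2; apply: (@le_trans _ _ (center_r (t ^+ 2) ^+ 2 * (1 + 120 * e) - pi / 2 * t ^+ 2)).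
  apply: lerB => //; apply: (le_trans rho2); rewrite exprMn.
  rewrite ler_wpM2l ?sqr_ge0//.
  have : e ^+ 2 <= e by rewrite expr2 ler_piMl.
  lra.
have C6 : center_r (t ^+ 2) ^+ 2 <= 6 by lra.
have : e * center_r (t ^+ 2) ^+ 2 <= e * 6 by rewrite ler_wpM2l.
have : 157 / 100 * t ^+ 2 <= pi / 2 * t ^+ 2 by rewrite ler_wpM2r//; lra.
lra.
Qed.

(** First [I * B] is at least [t * center_b] minus [15 e]; as [t * center_b <= 12 / 5], squaring
    costs [72 e], and the factor 4 makes it [288 e]. *)
Lemma numerator_b_le (B k e0 b0 e t g : R) : 0 <= t <= 8 / 5 -> 0 <= e <= 1 ->
  1 - e <= 2 * I * k -> `|e0| <= e -> `|b0| <= 2 * e ->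
  b0 + e0 * t ^+ 2 + 2 * k * t + 2 * k * (1 - e) * t * (center_b (t ^+ 2) - 1) <= B ->
  exp_lo (t ^+ 2) <= g -> (1 + t ^+ 2) ^+ 2 - 4 * B ^+ 2 <= g + 288 * e.
Proof.
move=> /andP[t0 t1] /andP[e0_ e1] mge e0le b0le Bge gl.
have pi3 := @pi_gt_314 R; have pi4 := @pi_lt_22_7 R.
have I2 : I ^+ 2 = pi / 2 by rewrite sqr_sqrtr// divr_ge0// pi_ge0.
have /andP[I_ge1 I_le2] := @sqrt_pihalf_bounds R.
have tT : t ^+ 2 <= 64 / 25.
  have -> : 64 / 25 = (8 / 5) ^+ 2 :> R by field.
  by rewrite ler_sqr ?nnegrE//; lra.
have u0 : 0 <= t ^+ 2 by exact: sqr_ge0.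
have uT : 0 <= t ^+ 2 <= 64 / 25 by rewrite u0.
have /andP[S1 S2] := center_b_bounds uT.
have tS0 : 0 <= t * center_b (t ^+ 2) by rewrite mulr_ge0//; lra.
have tS : t * center_b (t ^+ 2) <= 12 / 5.
  apply: (@le_trans _ _ (8 / 5 * (3 / 2))); last lra.
  by apply: ler_pM => //; lra.
have IB : t * center_b (t ^+ 2) - 15 * e <= I * B.
  have I0 : 0 < I by lra.
  apply: le_trans (ler_wpM2l (ltW I0) Bge).
  have h1 : - (4 * e) <= I * b0.
    have : - (2 * e) <= b0 by move: b0le; rewrite ler_norml => /andP[].
    have : I * e <= 2 * e by rewrite ler_wpM2r.
    by move=> h2 /(ler_wpM2l (ltW I0)); lra.
  have h2 : - (6 * e) <= I * (e0 * t ^+ 2).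
    have e0l : - e <= e0 by move: e0le; rewrite ler_norml => /andP[].
    have h3 : - e * t ^+ 2 <= e0 * t ^+ 2 by rewrite ler_wpM2r.
    have h4 : e * t ^+ 2 <= e * (64 / 25) by rewrite ler_wpM2l.
    have h5 : - (e * (64 / 25)) <= e0 * t ^+ 2 by lra.
    have : I * e <= 2 * e by rewrite ler_wpM2r.
    by have := ler_wpM2l (ltW I0) h5; lra.
  have h3 : (1 - e) * t <= 2 * I * k * t by rewrite ler_wpM2r.
  move: (center_b _) S1 tS tS0 => S S1 tS tS0.
  have h4 : (1 - e) * ((1 - e) * t * (S - 1)) <= 2 * I * k * ((1 - e) * t * (S - 1)).
    by rewrite ler_wpM2r// !mulr_ge0// ?subr_ge0.
  have h5 : 0 <= e ^+ 2 * (t * (S - 1)) by rewrite !mulr_ge0 ?sqr_ge0// subr_ge0.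
  have h6 : e * (t * S) <= e * (12 / 5) by rewrite ler_wpM2l.
  have h7 : 0 <= e * t by rewrite mulr_ge0.
  lra.
have IB2 : (t * center_b (t ^+ 2)) ^+ 2 - 72 * e <= pi / 2 * B ^+ 2.
  rewrite -I2 -exprMn; move: (I * B) (t * center_b (t ^+ 2)) IB tS0 tS => y m ym m0 m1.
  have em : e * m <= e * (12 / 5) by rewrite ler_wpM2l.
  (* Squaring is monotone only if [m - 15 e >= 0]; otherwise [m] is so small that the left-hand side
     is nonpositive. *)
  have [me|me] := leP (15 * e) m.
    have h : (m - 15 * e) ^+ 2 <= y ^+ 2 by rewrite ler_sqr ?nnegrE; lra.
    by have := sqr_ge0 e; lra.
  have := sqr_ge0 y; have : m * m <= 15 * e * m by rewrite ler_wpM2r// ltW.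
  lra.
have S20 : 0 <= t ^+ 2 * center_b (t ^+ 2) ^+ 2 by rewrite mulr_ge0 ?sqr_ge0.
have B4 : 4 * (7 / 11 * (t ^+ 2 * center_b (t ^+ 2) ^+ 2)) - 288 * e <= 4 * B ^+ 2.
  have pi0 : 0 < pi / 2 :> R by lra.
  rewrite -(ler_pM2l pi0).
  rewrite exprMn in IB2; move: (t ^+ 2 * center_b (t ^+ 2) ^+ 2) IB2 S20 => W IB2 W0.
  have h1 : pi / 2 * W <= 11 / 7 * W by rewrite ler_wpM2r//; lra.
  have h2 : 1 * e <= pi / 2 * e by rewrite ler_wpM2r//; lra.
  lra.
have ineq := center_b_ineq uT; lra.
Qed.

End CentralCoefficients.

(** * Suprema *)

Section UniformBounds.
Context {R : realType}.
Implicit Types a s t z e : R.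

Local Notation P := gamma_cdf.
Local Notation zt := gamma_point.
Local Notation dt := scaled_density.
Local Notation I := (Num.sqrt (pi / 2) : R).

Let I0 : 0 < I.
Proof. by have /andP[h _] := @sqrt_pihalf_bounds R; exact: lt_le_trans h. Qed.

(** Turns additive errors into relative ones. Halving the exponent first keeps the linear bound
    [exp (- x) >= 1 - x] good enough: [(9 / 25) ^ 2 >= 1 / 8]. *)
Lemma expR_ge_eighth t : t ^+ 2 <= 64 / 25 -> 1 <= 8 * expR (- (t ^+ 2 / 2)).
Proof.
move=> tT; have -> : expR (- (t ^+ 2 / 2)) = expR (- (t ^+ 2 / 4)) ^+ 2.
  by rewrite [RHS]expr2 -expRD; congr expR; field.
have := expR_ge1Dx (- (t ^+ 2 / 4)); move: (expR _) => y yge.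
have yge' : 9 / 25 <= y by lra.
by have := sqr_ge0 (y - 9 / 25); lra.
Qed.

(** The 8 comes from [expR_ge_eighth], the 720 from [numerator_r_le], the fifth power from
    [ratio_le]. *)
Definition central_bound e : R := (1 + 8 * 720 * e) / (1 - e) ^+ 5.

Lemma central_diff0_le a s e : 0 < a -> s ^+ 2 = 1 ->
  2 * I * mode_height a <= 1 + e -> e < 1 -> `|P a a - 2^-1| <= e ->
  8 / 5 <= e * Num.sqrt a -> `|central_diff a s 0| <= 2 * e.
Proof.
move=> a0 s1 m2 e1 Ple Tec; have k0 := mode_height_gt0 a0.
have c0 : 0 < Num.sqrt a by rewrite sqrtr_gt0.
have sabs : `|s| = 1 by have [->|->] := sqr_sign_cases s1; rewrite ?normrN normr1.
have sPle : `|s * (P a a - 2^-1)| <= e by rewrite normrM sabs mul1r.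
rewrite central_diff0//; apply: (le_trans (ler_normB _ _)).
have k_c : `|s * (mode_height a / Num.sqrt a)| <= e.
  rewrite normrM sabs mul1r ger0_norm; last by rewrite divr_ge0// ltW.
  rewrite ler_pdivrMr//.
  have /andP[I1 _] := @sqrt_pihalf_bounds R.
  have kI : mode_height a <= I * mode_height a by rewrite ler_peMl// ltW.
  lra.
lra.
Qed.

Lemma central_coefficients e : 0 < e -> e < 1 -> exists2 A, 1 <= A &
  forall a s t, A <= a -> s ^+ 2 = 1 -> 0 <= t <= 8 / 5 ->
    [/\ I * (Num.sqrt a * C1 a (zt a s t)) <= central_bound e,
        I * (zt a s t * C1 a (zt a s t) / Num.sqrt a) <= central_bound e &
        2 * (Num.sqrt a * C2 a (zt a s t)) / I <= central_bound e].
Proof.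
move=> e0 e1.
have T0 : 0 < 8 / 5 :> R by lra.
have [A1 A11 H1] := @scaled_density_uniform R _ e T0 e0 (ltW e1).
have [A2 A21 H2] := @mode_asymptotics R e e0 (ltW e1).
exists (Num.max A1 A2); first by rewrite le_max A11.
move=> a s t; rewrite ge_max => /andP[aA1 aA2] s1 tT.
have a0 : 0 < a by exact: lt_le_trans (lt_le_trans ltr01 A11) aA1.
have [Tec Tc unif] := H1 _ aA1; have [/andP[m1 m2] Ple] := H2 _ aA2.
have k0 := mode_height_gt0 a0.
have c0 : 0 < Num.sqrt a by rewrite sqrtr_gt0.
have e01 : 0 <= e <= 1 by rewrite !ltW.
have /andP[t0 t1] := tT.
have tc : t < Num.sqrt a by exact: le_lt_trans Tc.
have sabs : `|s| = 1 by have [->|->] := sqr_sign_cases s1; rewrite ?normrN normr1.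
have sPle : `|s * (P a a - 2^-1)| <= e by rewrite normrM sabs mul1r.
have tce : t / Num.sqrt a <= e.
  by rewrite ler_pdivrMr//; exact: le_trans Tec.
have w_ge : 1 - e <= 1 + s * t / Num.sqrt a.
  have t_c0 : 0 <= t / Num.sqrt a by rewrite divr_ge0// ltW.
  by rewrite -mulrA; have [h|h] := sqr_sign_cases s1; rewrite h; lra.
have dt0 := scaled_density_gt0 a0 s1 t0 tc.
pose g := expR (- (t ^+ 2 / 2)).
have tT2 : t ^+ 2 <= 64 / 25.
  have -> : 64 / 25 = (8 / 5) ^+ 2 :> R by field.
  by rewrite ler_sqr ?nnegrE//; lra.
have u0 : 0 <= t ^+ 2 / 2 by rewrite divr_ge0 ?sqr_ge0.
have g_lo : exp_lo (t ^+ 2) <= g.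
  by apply: le_trans (expRN_ge5 u0); rewrite /exp_lo; lra.
have g1 : g <= 1 by rewrite /g -[leRHS]expR0 ler_expR; lra.
have g8 : 1 <= 8 * g by exact: expR_ge_eighth.
have g0 : 0 < g by exact: expR_gt0.
(* One factor [1 - e] comes from the Gaussian comparison, the other from the height. *)
have D_ge : g * (1 - e) ^+ 2 <= 2 * I * dt a s t.
  have /andP[h _] := unif s t s1 tT.
  apply: le_trans (ler_wpM2l _ h); last by rewrite mulr_ge0 ?ltW.
  have f0 : 0 <= g * (1 - e) by apply: mulr_ge0; [exact: ltW|rewrite subr_ge0 ltW].
  by move: (ler_wpM2r f0 m1); rewrite -/g; clear; lra.
clearbody g.
have numeq : g + 720 * e <= g * (1 + 8 * 720 * e).
  by move: (ler_wpM2r (ltW e0) g8); clear; lra.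
have Nr : (2 * I) ^+ 2 * (central_sum a s t ^+ 2 - t ^+ 2 / 4) <= g * (1 + 8 * 720 * e).
  apply: le_trans numeq.
  apply: (numerator_r_le tT e01 m2 (ltW k0) sPle (central_sum_ge0 a0 s1 t0 tc)).
    exact: (central_sum_le a0 s1 Tc e01 (fun t => unif s t s1)).
  by rewrite g_lo.
have b0 := central_diff0_le a0 s1 m2 e1 Ple Tec.
have Nb : (1 + t ^+ 2) ^+ 2 - 4 * central_diff a s t ^+ 2 <= g * (1 + 8 * 720 * e).
  apply: le_trans numeq.
  apply: (@le_trans _ _ (g + 288 * e)); last by rewrite lerD2l ler_pM2r// ler_nat.
  apply: (numerator_b_le tT e01 m1 sPle b0 _ g_lo).
  exact: (central_diff_ge a0 s1 Tc e01 (fun t => unif s t s1)).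
have K0 : 0 <= 8 * 720 :> R := mulr_ge0 (ler0n R 8) (ler0n R 720).
have IC1 : I * (Num.sqrt a * C1 a (zt a s t)) = (2 * I) ^+ 2 * (central_sum a s t ^+ 2 - t ^+ 2 / 4) /
    ((1 + s * t / Num.sqrt a) ^+ 2 * (2 * I * dt a s t)).
  rewrite C1_central//; move: (1 + s * t / Num.sqrt a) w_ge => w w_ge.
  have w0 : 0 < w by apply: lt_le_trans w_ge; rewrite subr_gt0.
  by field; rewrite !gt_eqF.
split.
- rewrite IC1; exact: (ratio_le (ltW e0) e1 K0 g0 Nr D_ge w_ge).
(* Since [z = a w] with [w = 1 + s t / sqrt a], the weight [z] removes one power of [w] from the
   denominator. *)
- have -> : I * (zt a s t * C1 a (zt a s t) / Num.sqrt a) =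
      (1 + s * t / Num.sqrt a) * (I * (Num.sqrt a * C1 a (zt a s t))).
    move: (C1 a (zt a s t)) => C.
    rewrite /gamma_point -{1}(sqr_sqrtr (ltW a0)).
    by move: (Num.sqrt a) c0 => c c0; field; rewrite gt_eqF.
  rewrite IC1; move: (1 + s * t / Num.sqrt a) w_ge => w w_ge.
  have w0 : 0 < w by apply: lt_le_trans w_ge; rewrite subr_gt0.
  have := ratio_le (ltW e0) e1 K0 g0 Nr D_ge w_ge (isT : 1 <= 3)%N.
  apply: le_trans; rewrite le_eqVlt; apply/orP; left; apply/eqP.
  by field; rewrite !gt_eqF.
- have -> : 2 * (Num.sqrt a * C2 a (zt a s t)) / I =
      ((1 + t ^+ 2) ^+ 2 - 4 * central_diff a s t ^+ 2) /
      ((1 + s * t / Num.sqrt a) ^+ 3 * (2 * I * dt a s t)).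
    rewrite C2_central//; move: (1 + s * t / Num.sqrt a) w_ge => w w_ge.
    have w0 : 0 < w by apply: lt_le_trans w_ge; rewrite subr_gt0.
    by field; rewrite !gt_eqF.
  exact: (ratio_le (ltW e0) e1 K0 g0 Nb D_ge w_ge).
Qed.

(** Reduces to [2 pi a <= (z - a) ^ 2 + 4 z] and [(32 / pi) a <= (z - a - 1) ^ 2 + 8 z]. The
    distance [8 / 5] works because [64 / 25 + 4 > 44 / 7 > 2 pi] and
    [64 / 25 + 8 > 320 / 31 > 32 / pi]; [sqrt a >= 100] absorbs the lower-order terms. *)
Lemma outer_coefficients a z : 10 ^+ 4 <= a -> 0 < z ->
  8 / 5 * Num.sqrt a <= `|z - a| ->
  [/\ I * (Num.sqrt a * C1 a z) <= 1, I * (z * C1 a z / Num.sqrt a) <= 1 &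
      2 * (Num.sqrt a * C2 a z) / I <= 1].
Proof.
move=> a4 z0 za; have a1 : 1 <= a by apply: le_trans a4; rewrite expr_ge1// ler1n.
have a0 : 0 < a by exact: lt_le_trans a1.
have pi3 := @pi_gt_314 R; have pi4 := @pi_lt_22_7 R.
have I2 : I ^+ 2 = pi / 2 by rewrite sqr_sqrtr// divr_ge0// pi_ge0.
have c0 : 0 < Num.sqrt a by rewrite sqrtr_gt0.
have cE : a = Num.sqrt a ^+ 2 by rewrite sqr_sqrtr// ltW.
have c100 : 100 <= Num.sqrt a.
  have -> : 100 = Num.sqrt (10 ^+ 4) :> R.
    have -> : 10 ^+ 4 = 100 ^+ 2 :> R by ring.
    by rewrite sqrtr_sqr ger0_norm.
  by rewrite ler_wsqrtr.
have C10 := C1_ge0 a0 z0; have C20 := C2_ge0 a0 z0.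
have h1 := C1_sqrt_le a1 z0; have h2 := C2_sqrt_le a1 z0.
have key (X D M : R) : 0 <= X -> 0 <= M -> M ^+ 2 <= D -> X * Num.sqrt D <= 2 ->
    X * M <= 2.
  move=> X0 M0 MD; apply: le_trans; apply: ler_wpM2l => //.
  by rewrite -(ger0_norm M0) -sqrtr_sqr ler_wsqrtr.
set c := Num.sqrt a in c0 cE c100 za *.
have cases : z - a <= - (8 / 5 * c) \/ 8 / 5 * c <= z - a.
  by move: za; rewrite ler_normr => /orP[h|h]; [right|left]; lra.
have c2 : 100 * c <= c ^+ 2 by rewrite expr2 ler_wpM2r// ltW.
have sq4 : 44 / 7 * a <= (z - a) ^+ 2 + 4 * z.
  have -> : (z - a) ^+ 2 + 4 * z = (z - a) ^+ 2 + 4 * (z - a) + 4 * a by ring.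
  move: (z - a) cases => d cases; rewrite cE; clear -cases c0 c100 c2.
  case: cases => h.
    have : 0 <= (- d - 8 / 5 * c) * (- d + 8 / 5 * c - 4) by rewrite mulr_ge0//; lra.
    lra.
  have : 0 <= (d - 8 / 5 * c) * (d + 8 / 5 * c) by rewrite mulr_ge0//; lra.
  lra.
have sq8 : 320 / 31 * a <= (z - a - 1) ^+ 2 + 8 * z.
  have -> : (z - a - 1) ^+ 2 + 8 * z = (z - a) ^+ 2 + 6 * (z - a) + 1 + 8 * a.
    by ring.
  move: (z - a) cases => d cases; rewrite cE; clear -cases c0 c100 c2.
  case: cases => h.
    have : 0 <= (- d - 8 / 5 * c) * (- d + 8 / 5 * c - 6) by rewrite mulr_ge0//; lra.
    lra.
  have : 0 <= (d - 8 / 5 * c) * (d + 8 / 5 * c) by rewrite mulr_ge0//; lra.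
  lra.
have r1 : I * (c * C1 a z) <= 1.
  have : C1 a z * (2 * I * c) <= 2.
    apply: key h1 => //; first by rewrite !mulr_ge0 ?ltW.
    rewrite !exprMn I2 -cE; apply: le_trans sq4.
    by rewrite ler_pM2r//; lra.
  lra.
split => //.
(* For [z <= a] the weight [z / sqrt a] is at most [sqrt a], so the first bound suffices. *)
- have [zlea|altz] := leP z a.
    apply: le_trans r1; rewrite ler_pM2l// ler_pdivrMr// [c * _]mulrC -mulrA -expr2 -cE.
    by rewrite mulrC; apply: ler_wpM2l; [exact: C10|exact: zlea].
  have sz : 44 / 7 * z ^+ 2 <= a * ((z - a) ^+ 2 + 4 * z).
    (* In the variables [c = sqrt a] and [w = (z - a) / c] the factor [c ^ 2] splits off and a
       polynomial inequality for [c >= 100], [w >= 8 / 5] remains. *)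
    have [w [w1 zE]] : exists w, 8 / 5 <= w /\ z = c ^+ 2 + c * w.
      exists ((z - a) / c); split.
        by rewrite ler_pdivlMr//; case: cases => // h; lra.
      by rewrite mulrCA divff ?gt_eqF// mulr1 -cE addrC subrK.
    rewrite zE cE -subr_ge0.
    have -> : c ^+ 2 * ((c ^+ 2 + c * w - c ^+ 2) ^+ 2 + 4 * (c ^+ 2 + c * w)) -
        44 / 7 * (c ^+ 2 + c * w) ^+ 2 =
        c ^+ 2 * (c ^+ 2 * w ^+ 2 - 16 / 7 * c ^+ 2 - 60 / 7 * (c * w) - 44 / 7 * w ^+ 2).
      by field.
    rewrite mulr_ge0 ?sqr_ge0//; clear -c0 c100 c2 w1.
    have w2 : 64 / 25 <= w ^+ 2.
      have : 0 <= (w - 8 / 5) * (w + 8 / 5) by rewrite mulr_ge0//; lra.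
      lra.
    have w20 : 0 <= w ^+ 2 by exact: sqr_ge0.
    have h3 : c ^+ 2 * (64 / 25) <= c ^+ 2 * w ^+ 2 by rewrite ler_wpM2l// sqr_ge0.
    have h4 : 100 * c * w ^+ 2 <= c ^+ 2 * w ^+ 2 by rewrite ler_wpM2r.
    have h5 : 100 * w ^+ 2 <= c * w ^+ 2 by rewrite ler_wpM2r.
    have h6 : c * w * (8 / 5) <= c * w * w by rewrite ler_wpM2l// mulr_ge0 ?(ltW c0)//; lra.
    lra.
  have : C1 a z * (2 * I * (z / c)) <= 2.
    apply: key h1 => //; first by rewrite !mulr_ge0 ?invr_ge0 ?ltW.
    rewrite !exprMn I2 exprVn -cE mulrA ler_pdivrMr// [leRHS]mulrC.
    by apply: le_trans sz; rewrite ler_pM2r ?exprn_gt0//; lra.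
  lra.
- rewrite ler_pdivrMr// mul1r.
  have : C2 a z * (4 * c / I) <= 2.
    apply: key h2 => //; first by rewrite !mulr_ge0 ?invr_ge0 ?ltW.
    rewrite !exprMn exprVn I2 -cE; apply: le_trans sq8.
    rewrite ler_pdivrMr; last lra.
    have : a * (31 / 20) <= a * (pi / 2).
      by apply: ler_wpM2l; [exact: ltW|lra].
    lra.
  rewrite [C2 a z * _]mulrA ler_pdivrMr//; lra.
Qed.

End UniformBounds.

Section Suprema.
Context {R : realType}.
Implicit Types a z e M : R.

Local Notation I := (Num.sqrt (pi / 2) : R).

Let I0 : 0 < I.
Proof. by have /andP[h _] := @sqrt_pihalf_bounds R; exact: lt_le_trans h. Qed.

Lemma bounded_nonneg_itv0y (f : R -> R) M : (forall z, 0 < z -> 0 <= f z <= M) ->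
  [bounded f z | z in `]0, +oo[].
Proof.
move=> fM; rewrite /bounded_near; near=> N.
have MN : M <= N by near: N; exact: nbhs_pinfty_ge (num_real _).
move=> z /=; rewrite in_itv/= andbT => z0.
by have /andP[f0 fle] := fM _ z0; rewrite ger0_norm// (le_trans fle).
Unshelve. all: by end_near. Qed.

Lemma ereal_sup_itv0y (f : R -> R) M a : 0 < a -> (forall z, 0 < z -> f z <= M) ->
  let S := ereal_sup [set (f z)%:E | z in `]0, +oo[] in
  S \is a fin_num /\ f a <= fine S <= M.
Proof.
move=> a0 fM S; have SM : (S <= M%:E)%E.
  apply: ge_ereal_sup => _ [z z0 <-]; rewrite lee_fin; apply: fM.
  by move: z0; rewrite /= in_itv/= andbT.
have aS : ((f a)%:E <= S)%E.
  by apply: ereal_sup_ubound; exists a => //=; rewrite in_itv/= andbT.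
have Sfin : S \is a fin_num.
  rewrite fin_numElt (lt_le_trans _ aS) ?ltNyr//=.
  by rewrite (le_lt_trans SM) ?ltry.
by split => //; rewrite -!lee_fin fineK// aS.
Qed.

(** The half-line is split at distance [8 / 5 * sqrt a] from [a]; the outer bound 1 is absorbed by
    [1 <= central_bound e]. *)
Lemma coefficients_upper e : 0 < e -> e < 1 -> exists2 A, 1 <= A &
  forall a z, A <= a -> 0 < z ->
    [/\ I * (Num.sqrt a * C1 a z) <= central_bound e,
        I * (z * C1 a z / Num.sqrt a) <= central_bound e &
        2 * (Num.sqrt a * C2 a z) / I <= central_bound e].
Proof.
move=> e0 e1; have [A A1 HA] := @central_coefficients R e e0 e1.
exists (Num.max A (10 ^+ 4)); first by rewrite le_max A1.
move=> a z; rewrite ge_max => /andP[aA a4] z0.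
have a0 : 0 < a by exact: lt_le_trans (lt_le_trans ltr01 A1) aA.
have c0 : 0 < Num.sqrt a by rewrite sqrtr_gt0.
have bnd1 : 1 <= central_bound e.
  rewrite /central_bound ler_pdivlMr ?exprn_gt0 ?subr_gt0// mul1r.
  apply: (@le_trans _ _ 1).
    by apply: exprn_ile1; lra.
  rewrite lerDl.
  exact: (mulr_ge0 (mulr_ge0 (ler0n R 8) (ler0n R 720)) (ltW e0)).
have [outer|inner] := leP (8 / 5 * Num.sqrt a) `|z - a|.
  have [h1 h2 h3] := outer_coefficients a4 z0 outer.
  by split; exact: le_trans bnd1.
pose s : R := if a <= z then 1 else -1.
have s1 : s ^+ 2 = 1 by rewrite /s; case: ifP; rewrite ?sqrrN expr1n.
have zE : z = gamma_point a s (`|z - a| / Num.sqrt a).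
  rewrite /gamma_point.
  have -> : s * Num.sqrt a * (`|z - a| / Num.sqrt a) = s * `|z - a|.
    by field; rewrite gt_eqF.
  rewrite /s.
  have [az|za] := leP a z.
    by rewrite ger0_norm ?subr_ge0//; ring.
  by rewrite ltr0_norm ?subr_lt0//; ring.
rewrite {}zE; apply: HA => //; rewrite divr_ge0 ?(ltW c0)//=.
by rewrite ler_pdivrMr// ltW.
Qed.

(** At [z = a] the first two quantities equal [2 * I * mode_height a] exactly; the third differs
    from its inverse only through [central_diff a 1 0], at most [2 e] in size. *)
Lemma coefficients_lower e : 0 < e -> e <= 1 / 4 -> exists2 A, 1 <= A &
  forall a, A <= a ->
    [/\ 1 - e <= I * (Num.sqrt a * C1 a a), 1 - e <= I * (a * C1 a a / Num.sqrt a) &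
        (1 - 16 * e ^+ 2) / (1 + e) <= 2 * (Num.sqrt a * C2 a a) / I].
Proof.
move=> e0 e4; have T0 : 0 < 8 / 5 :> R by lra.
have e1 : e < 1 by lra.
have [A1 A11 H1] := @scaled_density_uniform R _ e T0 e0 (ltW e1).
have [A2 A21 H2] := @mode_asymptotics R e e0 (ltW e1).
exists (Num.max A1 A2); first by rewrite le_max A11.
move=> a; rewrite ge_max => /andP[aA1 aA2].
have a0 : 0 < a by exact: lt_le_trans (lt_le_trans ltr01 A11) aA1.
have [Tec Tc _] := H1 _ aA1; have [/andP[m1 m2] Ple] := H2 _ aA2.
have k0 := mode_height_gt0 a0.
have c0 : 0 < Num.sqrt a by rewrite sqrtr_gt0.
have s1 : 1 ^+ 2 = 1 :> R by rewrite expr1n.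
have b0 := central_diff0_le a0 s1 m2 e1 Ple Tec.
have r1 : I * (Num.sqrt a * C1 a a) = 2 * I * mode_height a.
  have := C1_central a0 s1 (lexx 0) c0.
  rewrite gamma_point0 scaled_density0 central_sum0// => ->.
  by field; rewrite !gt_eqF.
split.
- by rewrite r1.
- have -> : a * C1 a a / Num.sqrt a = Num.sqrt a * C1 a a.
    rewrite -{1}(sqr_sqrtr (ltW a0)); move: (C1 a a) (Num.sqrt a) c0 => C c c0.
    by field; rewrite gt_eqF.
  by rewrite r1.
- have := C2_central a0 s1 (lexx 0) c0.
  rewrite gamma_point0 scaled_density0 => ->.
  have -> : 2 * (((1 + 0 ^+ 2) ^+ 2 / 4 - central_diff a 1 0 ^+ 2) /
      ((1 + 1 * 0 / Num.sqrt a) ^+ 3 * mode_height a)) / I =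
      (1 - 4 * central_diff a 1 0 ^+ 2) / (2 * I * mode_height a).
    by field; rewrite !gt_eqF.
  have bb : central_diff a 1 0 ^+ 2 <= 4 * e ^+ 2.
    rewrite -real_normK ?num_real//.
    have := ler_pM (normr_ge0 _) (normr_ge0 _) b0 b0; lra.
  have D0 : 0 < 2 * I * mode_height a.
    by apply: mulr_gt0 => //; apply: mulr_gt0 => //; exact: I0.
  have N1 : 1 - 16 * e ^+ 2 <= 1 - 4 * central_diff a 1 0 ^+ 2 by lra.
  rewrite ler_pdivlMr// mulrAC ler_pdivrMr; last lra.
  (* This makes [1 - 16 e ^ 2] nonnegative, as the product of inequalities requires. *)
  have e16 : e ^+ 2 <= 1 / 16.
    have := ler_pM (ltW e0) (ltW e0) e4 e4; lra.
  by apply: ler_pM => //; [lra|exact: ltW].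
Qed.

Lemma cvg_pinfty1 (G : R -> R) : (forall e, 0 < e -> e <= 1 -> exists2 A, 1 <= A &
    forall a, A <= a -> 1 - e <= G a <= 1 + e) -> G a @[a --> +oo] --> (1 : R).
Proof.
move=> GA; apply/cvgrPdist_le => e e0.
have m0 : 0 < Num.min e 1 by rewrite lt_min e0 ltr01.
have m1 : Num.min e 1 <= 1 by rewrite ge_min lexx orbT.
have [A _ HA] := GA _ m0 m1; near=> a.
have aA : A <= a by near: a; exact: nbhs_pinfty_ge (num_real _).
have /andP[h1 h2] := HA _ aA.
have me : Num.min e 1 <= e by rewrite ge_min lexx.
by rewrite ler_norml; apply/andP; split; lra.
Unshelve. all: by end_near. Qed.

End Suprema.

(** * Limits of the normalized suprema *)

Section SupremumLimits.
Context {R : realType}.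
Implicit Types a z e : R.

Local Notation I := (Num.sqrt (pi / 2) : R).

Let I0 : 0 < I.
Proof. by have /andP[h _] := @sqrt_pihalf_bounds R; exact: lt_le_trans h. Qed.

(** The supremum is squeezed between the value at [z = a] and the uniform upper bound. *)
Lemma scaled_sup_cvg (f : R -> R -> R) (k : R -> R) :
  (forall a, 0 < a -> 0 < k a) ->
  (forall e, 0 < e -> e <= 1 -> exists2 A, 1 <= A & forall a, A <= a ->
    (forall z, 0 < z -> k a * f a z <= 1 + e) /\ 1 - e <= k a * f a a) ->
  k a * fine (ereal_sup [set (f a z)%:E | z in `]0, +oo[]) @[a --> +oo] --> (1 : R).
Proof.
move=> k0 H; apply: cvg_pinfty1 => e e0 e1; have [A A1 HA] := H e e0 e1.
exists A => // a aA; have a0 : 0 < a by exact: lt_le_trans (lt_le_trans ltr01 A1) aA.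
have [up lo] := HA a aA; have ka := k0 a a0.
have fM z : 0 < z -> f a z <= (1 + e) / k a.
  by move=> z0; rewrite ler_pdivlMr// mulrC; exact: up.
have [_ /andP[h1 h2]] := @ereal_sup_itv0y R (f a) _ a a0 fM.
by rewrite (le_trans lo) ?ler_pM2l//= mulrC -ler_pdivlMr.
Qed.

(** Bernoulli's inequality [(1 - e) ^ 5 >= 1 - 5 e] makes the bound linear; [K >= 10] lets the
    numerator error dominate [5 e]. *)
Lemma central_bound_le (K e : R) : 10 <= K -> 0 < e -> 4 * (K * e) <= 1 ->
  (1 + K * e) / (1 - e) ^+ 5 <= 1 + 4 * (K * e).
Proof.
move=> K10 e0 Ke1; have Ke10 : 10 * e <= K * e by rewrite ler_wpM2r// ltW.
have e1 : e < 1 by lra.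
rewrite ler_pdivrMr ?exprn_gt0 ?subr_gt0//.
have e2 : 0 <= e ^+ 2 by exact: sqr_ge0.
have bern : 1 - 5 * e <= (1 - e) ^+ 5.
  have -> : (1 - e) ^+ 5 = 1 - 5 * e + e ^+ 2 * (10 * (1 - e) + e ^+ 2 * (5 - e)).
    by ring.
  by rewrite lerDl mulr_ge0// addr_ge0 ?mulr_ge0//; lra.
apply: (@le_trans _ _ ((1 + 4 * (K * e)) * (1 - 5 * e))).
  have : 4 * (K * e) * e <= 1 * e by rewrite ler_wpM2r// ltW.
  lra.
by rewrite ler_wpM2l//; lra.
Qed.

Lemma coefficients_asymptotics e : 0 < e -> e <= 1 -> exists2 A, 1 <= A &
  forall a, A <= a ->
  [/\ (forall z, 0 < z -> I * Num.sqrt a * C1 a z <= 1 + e) /\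
        1 - e <= I * Num.sqrt a * C1 a a,
      (forall z, 0 < z -> I / Num.sqrt a * (z * C1 a z) <= 1 + e) /\
        1 - e <= I / Num.sqrt a * (a * C1 a a) &
      (forall z, 0 < z -> 2 * Num.sqrt a / I * C2 a z <= 1 + e) /\
        1 - e <= 2 * Num.sqrt a / I * C2 a a].
Proof.
move=> e0 e1; pose K : R := 8 * 720.
have K10 : 10 <= K.
  apply: (@le_trans _ _ (8 * 10)); first by lra.
  by rewrite /K ler_pM2l// ler_nat.
have K0 : 0 < K by exact: lt_le_trans K10.
(* Chosen so that [4 K d = e], the error allowed by [central_bound_le]. *)
pose d := e / (4 * K); have d0 : 0 < d by rewrite divr_gt0// mulr_gt0.
have Kd : 4 * (K * d) = e by rewrite /d; field; rewrite gt_eqF.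
have Kd1 : 4 * (K * d) <= 1 by rewrite Kd.
have dE : central_bound d <= 1 + e.
  by have := @central_bound_le K d K10 d0 Kd1; rewrite Kd.
have d10 : 40 * d <= e.
  by rewrite -Kd; have : 10 * d <= K * d by [rewrite ler_wpM2r// ltW]; lra.
clearbody d.
have d1 : d < 1 by lra.
have d4 : d <= 1 / 4 by lra.
have [A1 A11 H1] := @coefficients_upper R d d0 d1.
have [A2 A21 H2] := @coefficients_lower R d d0 d4.
exists (Num.max A1 A2); first by rewrite le_max A11.
move=> a; rewrite ge_max => /andP[aA1 aA2].
have [l1 l2 l3] := H2 _ aA2.
split; split.
- move=> z z0; have [h _ _] := H1 a z aA1 z0.
  by rewrite -mulrA; exact: le_trans h dE.
- by rewrite -mulrA; apply: le_trans l1; lra.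
- move=> z z0; have [_ h _] := H1 a z aA1 z0.
  by rewrite -mulrA [_^-1 * _]mulrC; exact: le_trans h dE.
- by rewrite -mulrA [_^-1 * _]mulrC; apply: le_trans l2; lra.
- move=> z z0; have [_ _ h] := H1 a z aA1 z0.
  by rewrite mulrAC -[2 * _ * _]mulrA; exact: le_trans h dE.
- rewrite mulrAC -[2 * _ * _]mulrA; apply: le_trans l3.
  rewrite ler_pdivlMr; last lra.
  have : d * d <= d * (1 / 4) by rewrite ler_wpM2l// ltW.
  have : 0 <= e * d by rewrite mulr_ge0 ?ltW.
  lra.
Qed.

End SupremumLimits.

Unset Implicit Arguments.

Theorem propositionA1 (R : realType) :
  (forall a : R, 0 < a ->
    [/\ [bounded C1 a z | z in `]0, +oo[],
        [bounded z * C1 a z | z in `]0, +oo[] &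
        [bounded C2 a z | z in `]0, +oo[]] /\
    [/\ c_sup a \is a fin_num,
        d_sup a \is a fin_num &
        e_sup a \is a fin_num]) /\
  [/\ Num.sqrt a * fine (c_sup a) @[a --> +oo] --> Num.sqrt (2 / pi : R),
      fine (d_sup a) / Num.sqrt a @[a --> +oo] --> Num.sqrt (2 / pi : R) &
      Num.sqrt a * fine (e_sup a) @[a --> +oo] --> Num.sqrt (pi / 8 : R)].
Proof.
split.
  move=> a a0.
  have zC1_ge0 z : 0 < z -> 0 <= z * C1 a z.
    by move=> z0; apply: mulr_ge0; [exact: ltW|exact: C1_ge0].
  split; split.
  - apply: (@bounded_nonneg_itv0y R (C1 a) 2) => z z0.
    by rewrite C1_ge0// C1_le2.
  - apply: (@bounded_nonneg_itv0y R (fun z => z * C1 a z) (2 * (1 + a))) => z z0.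
    by rewrite zC1_ge0// mulr_C1_le.
  - apply: (@bounded_nonneg_itv0y R (C2 a) 2) => z z0.
    by rewrite C2_ge0// C2_le2.
  - by have [] := @ereal_sup_itv0y R (C1 a) 2 a a0 (fun z => @C1_le2 R a z a0).
  - by have [] := @ereal_sup_itv0y R (fun z => z * C1 a z) _ a a0
      (fun z => @mulr_C1_le R a z a0).
  - by have [] := @ereal_sup_itv0y R (C2 a) 2 a a0 (fun z => @C2_le2 R a z a0).
pose I : R := Num.sqrt (pi / 2).
have I0 : 0 < I.
  by have /andP[h _] := @sqrt_pihalf_bounds R; exact: lt_le_trans h.
have I2 : I ^+ 2 = pi / 2 by rewrite sqr_sqrtr// divr_ge0// pi_ge0.
have IV : Num.sqrt (2 / pi) = I^-1.
  have -> : 2 / pi = (I^-1) ^+ 2 :> R by rewrite exprVn I2 invf_div.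
  by rewrite sqrtr_sqr ger0_norm// invr_ge0 ltW.
have Ihalf : Num.sqrt (pi / 8) = I / 2.
  have -> : pi / 8 = (I / 2) ^+ 2 :> R by rewrite expr_div_n I2; field.
  by rewrite sqrtr_sqr ger0_norm// divr_ge0 ?ltW.
have sqrt0 (a : R) : 0 < a -> 0 < Num.sqrt a by rewrite sqrtr_gt0.
(* All three limits are reduced to limits equal to 1, with [k = I] for [w = sqrt (2 / pi)] and
   [k = 2 / I] for [w = sqrt (pi / 8)]. *)
have inv_cvg (G : R -> R) (k w : R) : k * w = 1 -> k * G a @[a --> +oo] --> (1 : R) ->
    G a @[a --> +oo] --> w.
  move=> kw kG; have -> : G = (fun a => w * (k * G a)).
    by apply/funext => a; rewrite mulrA [w * k]mulrC kw mul1r.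
  by rewrite -[X in _ --> X]mulr1; apply: cvgM => //; exact: cvg_cst.
split.
- rewrite IV; apply: (inv_cvg _ I); first by rewrite divff ?gt_eqF.
  under eq_fun do rewrite mulrA.
  apply: (@scaled_sup_cvg R C1 (fun a => I * Num.sqrt a)).
    by move=> a a0; rewrite mulr_gt0// sqrt0.
  move=> e e0 e1; have [A A1 HA] := @coefficients_asymptotics R e e0 e1.
  by exists A; [exact: A1|move=> a /HA[h _ _]; exact: h].
- rewrite IV; apply: (inv_cvg _ I); first by rewrite divff ?gt_eqF.
  under eq_fun do rewrite [fine _ / _]mulrC mulrA.
  apply: (@scaled_sup_cvg R (fun a z => z * C1 a z) (fun a => I / Num.sqrt a)).
    by move=> a a0; rewrite divr_gt0// sqrt0.
  move=> e e0 e1; have [A A1 HA] := @coefficients_asymptotics R e e0 e1.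
  by exists A; [exact: A1|move=> a /HA[_ h _]; exact: h].
- rewrite Ihalf; apply: (inv_cvg _ (2 / I)); first by field; rewrite gt_eqF.
  under eq_fun do rewrite mulrA [2 / I * _]mulrAC.
  apply: (@scaled_sup_cvg R C2 (fun a => 2 * Num.sqrt a / I)).
    by move=> a a0; rewrite divr_gt0// mulr_gt0// sqrt0.
  move=> e e0 e1; have [A A1 HA] := @coefficients_asymptotics R e e0 e1.
  by exists A; [exact: A1|move=> a /HA[_ _ h]; exact: h].
Qed.
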